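(* Consider the energy redistribution model with redistribution measure $\nu(s,d\epsilon)=\nu(s,\epsilon)\,d\epsilon$. (1) Let $\mu$ be a probability density on $[0,\infty)$. The product measure $\mu(x)\mu(y)\,dx\,dy$ on $[0,\infty)^2$ is invariant for the model if and only if $$\nu(s,a)=\frac{\mu(as)\,\mu((1-a)s)}{\int_0^1\mu(\alpha s)\,\mu((1-\alpha)s)\,d\alpha}$$ (for almost every $s>0$ at which the denominator is nonzero, and almost every $a\in[0,1]$). In that case the measure $\mu(x)\mu(y)\,dx\,dy$ is also reversible. More generally, if $\mu(x,y)$ is a probability density on $[0,\infty)^2$, then $\mu(x,y)\,dx\,dy$ is invariant if and only if $$\nu(s,a)=\frac{\mu(as,(1-a)s)}{\int_0^1\mu(\alpha s,(1-\alpha)s)\,d\alpha}$$ (for almost every $s>0$ at which the denominator is nonzero, and almost every $a\in[0,1]$). (2) Suppose $\nu(s,\epsilon)=\nu(\epsilon)$ does not depend on $s$. If $\mu$ is a probability density on $[0,\infty)$ such that the product measure $\mu(x)\mu(y)\,dx\,dy$ is invariant, then $\mu$ is of Gamma type: there are $b>0$ and $\lambda>0$ such that (almost everywhere) $$\mu(x)=\lambda^{b}\,\frac{x^{b-1}}{\Gamma(b)}\,e^{-\lambda x},$$ and the corresponding $\nu$ is the Beta distribution $$\nu(\epsilon)=\frac{1}{B(b,b)}\,\epsilon^{b-1}(1-\epsilon)^{b-1}.$$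
   Context: State space $E=[0,\infty)^2$. For $\epsilon\in[0,1]$ let $T_\epsilon:E\to E$, $T_\epsilon(x,y)=(\epsilon(x+y),(1-\epsilon)(x+y))$. A redistribution measure $\nu=\nu(s,d\epsilon)=\nu(s,\epsilon)\,d\epsilon$ is a weakly continuous map $s\mapsto\nu(s,\cdot)$ from $[0,\infty)$ into the space of absolutely continuous probability measures on $[0,1]$ with full support; $\nu(s,\epsilon)$ denotes the density. The energy redistribution model based on $\nu$ is the continuous-time Markov jump process on $E$ in which, from state $(x,y)$, after an exponential waiting time of mean one, the state is replaced by $T_\epsilon(x,y)$ with $\epsilon$ distributed according to $\nu(x+y,d\epsilon)$. Its generator on bounded continuous $f:E\to\mathbb R$ is $\mathcal L f=Pf-f$, where $Pf(x,y)=\int_0^1 f(T_\epsilon(x,y))\,\nu(x+y,\epsilon)\,d\epsilon$. A probability measure $m$ on $E$ is invariant if $\int Pf\,dm=\int f\,dm$ for all bounded continuous $f$, and reversible if $\int (Pf)\,g\,dm=\int f\,(Pg)\,dm$ for all bounded continuous $f,g$. $B$ denotes the Beta function and $\Gamma$ the Gamma function. *)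

(* Defs.v *)
From HB Require Import structures.
From mathcomp Require Import all_boot all_order all_algebra.
From mathcomp Require Import all_classical all_reals all_analysis.
From mathcomp Require Import measurable_realfun.

Set Implicit Arguments.
Unset Strict Implicit.
Unset Printing Implicit Defensive.

Import Order.TTheory GRing.Theory Num.Theory.
Import numFieldNormedType.Exports.

Local Open Scope classical_set_scope.
Local Open Scope ring_scope.

Section prob_density.
Context d (T : measurableType d) (R : realType).

(* Probability densities on the set D with respect to the measure m.
   The values of the function outside D are irrelevant. *)
Record prob_density (m : {measure set T -> \bar R}) (D : set T) := ProbDensity {
  density_fun :> T -> R ;
  density_dom : measurable D ;
  density_measurable : measurable_fun D density_fun ;
  density_ge0 : forall x, D x -> 0 <= density_fun x ;
  density_integral : (\int[m]_(x in D) (density_fun x)%:E = 1)%E }.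

(* f(x) m(dx) on D, seen as a measure on the ambient type carried by D. *)
Definition density_prob (m : {measure set T -> \bar R}) (D : set T)
    (f : prob_density m D) : set T -> \bar R :=
  fun A => (\int[m]_(x in A `&` D) (f x)%:E)%E.

End prob_density.

Section density_prob_instance.
Context d (T : measurableType d) (R : realType).
Variables (m : {measure set T -> \bar R}) (D : set T) (f : prob_density m D).

Let density_prob0 : density_prob f set0 = 0%E.
Proof. by rewrite /density_prob set0I integral_set0. Qed.

Let density_prob_ge0 A : (0 <= density_prob f A)%E.
Proof.
by apply: integral_ge0 => x [_ Dx]; rewrite lee_fin; exact: density_ge0.
Qed.

Let density_prob_sigma_additive : semi_sigma_additive (density_prob f).
Proof.
move=> F mF tF mUF.
have mD := density_dom f.
rewrite /density_prob setI_bigcupl ge0_integral_bigcup//.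
- apply: is_cvg_ereal_nneg_natsum_cond => n _ _.
  by apply: integral_ge0 => x [_ Dx]; rewrite lee_fin; exact: density_ge0.
- by move=> k; exact: measurableI.
- apply/measurable_EFinP; apply: measurable_funS (density_measurable f) => //.
  by move=> x [k _ []].
- by move=> x [k _ [_ Dx]]; rewrite lee_fin; exact: density_ge0.
- exact: trivIset_setIr.
Qed.

HB.instance Definition _ := isMeasure.Build _ _ _ (density_prob f)
  density_prob0 density_prob_ge0 density_prob_sigma_additive.

Let density_prob_setT : density_prob f setT = 1%E.
Proof. by rewrite /density_prob setTI density_integral. Qed.

HB.instance Definition _ := Measure_isProbability.Build _ _ _ (density_prob f)
  density_prob_setT.

End density_prob_instance.

Section energy_redistribution.
Context (R : realType).

Notation leb := (@lebesgue_measure R).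

Definition halfline : set (measurableTypeR R) := `[0, +oo[%classic.

Definition unit_itv : set (measurableTypeR R) := `[0, 1]%classic.

(* The state space E = [0, oo)^2, as a subset of R^2. Measures and functions
   on E are measures carried by E and functions used on E only. *)
Definition quadrant : set (measurableTypeR R * measurableTypeR R) :=
  halfline `*` halfline.

Lemma measurable_quadrant : measurable quadrant.
Proof. by apply: measurableX; exact: measurable_itv. Qed.

Section prod_density.
Variable mu : prob_density leb halfline.

Lemma prod_density_measurable :
  measurable_fun quadrant (fun z => mu z.1 * mu z.2).
Proof.
have mH := density_dom mu.
apply: measurable_funM.
- apply: (measurable_comp mH _ (density_measurable mu)).
    by move=> _ [z [z1 _] <-].
  exact: measurable_funTS.
- apply: (measurable_comp mH _ (density_measurable mu)).
    by move=> _ [z [_ z2] <-].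
  exact: measurable_funTS.
Qed.

Lemma prod_density_ge0 z : quadrant z -> 0 <= mu z.1 * mu z.2.
Proof. by move=> [z1 z2]; apply: mulr_ge0; exact: density_ge0. Qed.

Lemma prod_density_integral :
  (\int[(leb \x leb)%E]_(z in quadrant) (mu z.1 * mu z.2)%:E = 1)%E.
Proof.
have mH := density_dom mu.
have mg : measurable_fun setT (mu \_ halfline).
  by apply/measurable_restrict => //; rewrite setTI; exact: density_measurable.
have g0 x : 0 <= (mu \_ halfline) x.
  by apply: restrict_ge0 => y Hy; exact: density_ge0.
have g1 : (\int[leb]_x ((mu \_ halfline) x)%:E = 1)%E.
  rewrite -(density_integral mu) [RHS]integral_mkcond.
  by apply: eq_integral => x _; rewrite !patchE; case: ifP.
rewrite integral_mkcond.
transitivity (\int[(leb \x leb)%E]_z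
    ((mu \_ halfline) z.1 * (mu \_ halfline) z.2)%:E)%E.
  apply: eq_integral => -[x y] _; rewrite !patchE /quadrant in_setX/=.
  by case: (x \in halfline); case: (y \in halfline);
     rewrite /= ?mul0r ?mulr0.
rewrite fubini_tonelli1.
- under eq_integral => x _.
    rewrite /fubini_F/=.
    under eq_integral do rewrite EFinM.
    rewrite ge0_integralZl//; last 3 first.
      by apply/measurable_EFinP.
      by move=> y _; rewrite lee_fin.
      by rewrite lee_fin.
    rewrite g1 mule1; over.
  exact: g1.
- apply/measurable_EFinP; apply: measurable_funM.
    exact: (measurableT_comp mg measurable_fst).
  exact: (measurableT_comp mg measurable_snd).
- by move=> z; rewrite lee_fin mulr_ge0.
Qed.

Definition prod_density : prob_density (leb \x leb)%E quadrant :=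
  ProbDensity measurable_quadrant prod_density_measurable prod_density_ge0
    prod_density_integral.

End prod_density.

(* nu s a is the density nu(s, a) of nu(s, da) on [0, 1]. Only s >= 0 matters.
   Weak continuity is tested on continuous functions on the compact [0, 1],
   which are automatically bounded. No joint measurability of (s, a) |-> nu s a
   is assumed. *)
Record redistribution_measure := RedistributionMeasure {
  redist_density :> R -> prob_density leb unit_itv ;
  redist_full_support : forall s, 0 <= s ->
    forall U : set R, open U -> U `&` `[0, 1] !=set0 ->
    (0 < density_prob (redist_density s) U)%E ;
  redist_weak_continuous : forall h : R -> R,
    {within `[0, 1], continuous h} ->
    {within `[0, +oo[, continuous (fun s : R =>
      \int[leb]_(a in unit_itv) (h a * redist_density s a))} }.

Definition redist_map (e : R) (z : R * R) : R * R :=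
  (e * (z.1 + z.2), (1 - e) * (z.1 + z.2)).

Definition redist_op (nu : redistribution_measure) (f : R * R -> R)
    (z : R * R) : R :=
  \int[leb]_(e in unit_itv) (f (redist_map e z) * nu (z.1 + z.2) e).

Definition bounded_continuous (f : R * R -> R) : Prop :=
  {within (quadrant : set (R * R)), continuous f} /\
  exists M : R, forall z, quadrant z -> `|f z| <= M.

Definition invariant_measure (nu : redistribution_measure)
    (m : probability (measurableTypeR R * measurableTypeR R)%type R) : Prop :=
  forall f, bounded_continuous f ->
    \int[m]_(z in quadrant) redist_op nu f z = \int[m]_(z in quadrant) f z.

Definition reversible_measure (nu : redistribution_measure)
    (m : probability (measurableTypeR R * measurableTypeR R)%type R) : Prop :=
  forall f g, bounded_continuous f -> bounded_continuous g ->
    \int[m]_(z in quadrant) (redist_op nu f z * g z) =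
    \int[m]_(z in quadrant) (f z * redist_op nu g z).

Definition gamma_function (b : R) : R :=
  \int[leb]_(t in halfline) (t `^ (b - 1) * expR (- t)).

(* The library's beta_fun only takes natural number arguments. *)
Definition beta_function (a b : R) : R :=
  \int[leb]_(t in unit_itv) (t `^ (a - 1) * (1 - t) `^ (b - 1)).

End energy_redistribution.

(* Main.v *)
Require Import Defs.
From HB Require Import structures.
From mathcomp Require Import all_boot all_order all_algebra.
From mathcomp Require Import all_classical all_reals all_analysis.
From mathcomp Require Import measurable_realfun ring lra.

Import Order.TTheory GRing.Theory Num.Theory.
Import numFieldNormedType.Exports.

Local Open Scope classical_set_scope.
Local Open Scope ring_scope.

(* In the coordinates (s, a) with x = a s, y = (1 - a) s, the operator P
   replaces f(., s) by its nu(s, .)-mean and dx dy = s ds da. Hence the measure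
   is invariant if and only if its conditional law of a given s is nu(s, .) for
   almost every s, and P is then a conditional expectation, so it is
   self-adjoint. The test functions exp(- j (x + y) - n x) suffice, since an
   integrable function whose Laplace transform vanishes on a lattice is null.

   If nu does not depend on s, testing against x ^ p exp(- t (x + y)) with
   p = 1, 2 relates M_p(t) = \int x ^ p exp(- t x) mu(x) dx by
   M_2 M_0 = k M_1 ^ 2 for a constant k > 1 (Lukacs). As M_p' = - M_(p+1), the
   function M_0 / M_1 is affine, so M_0(t) = C (t + lam) ^ (- b), which is the
   Laplace transform of a Gamma density; nu is then read off from part (1). *)

(** The family (s, a) |-> [nu s a] carries no joint measurability, so Fubini is never applied to it.
    Two devices replace this. Weak continuity makes the [nu s]-mean of a bounded continuous function
    continuous in s, which supplies the measurability of P f. The comparison of [nu s] with the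
    conditional law is made slice by slice: for each n a null set of s is discarded, and after a
    countable union the two densities are compared at a fixed s. The test functions factor as exp (-
    j s) times exp (- n x), and s = x + y is conserved by the jump: the index j isolates s, then the
    index n isolates a.

    In the independent case the symmetry of the product measure forces the mean of nu to be 1/2. Its
    second moment c lies strictly between 1/4 and 1/2 because a density does not charge points, and
    k = 2 c / (1 - 2 c) > 1. The shift lam is positive because M_0 <= 1 rules out a blow-up of M_0
    at t = 0. *)

Section ae.
Context d (T : measurableType d) (R : realType) (m : {measure set T -> \bar R}).

Lemma aeS (P Q : T -> Prop) : (forall x, P x -> Q x) ->
  {ae m, forall x, P x} -> {ae m, forall x, Q x}.
Proof. by move=> PQ [N [mN N0 sub]]; exists N; split => // x /= nQ; apply/sub => /PQ. Qed.

Lemma aeI (P Q : T -> Prop) : {ae m, forall x, P x} ->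
  {ae m, forall x, Q x} -> {ae m, forall x, P x /\ Q x}.
Proof.
move=> [N [mN N0 subN]] [K [mK K0 subK]]; exists (N `|` K); split.
- exact: measurableU.
- exact: null_set_setU.
- move=> x /= /not_andP[nP|nQ]; [left; exact: subN|right; exact: subK].
Qed.

End ae.
Arguments aeI {d T R m P Q}.

(** * Integration against a measure given by a density *)

Section density_change.
Import HBNNSimple.
Context d (T : measurableType d) (R : realType).
Variables (m : {measure set T -> \bar R}) (D : set T) (f : prob_density m D).

(** Monotone convergence along simple functions increasing to g reduces the identity, by linearity,
    to indicators, where it is the definition of [density_prob]. *)
Lemma ge0_integral_density (g : T -> \bar R) :
  measurable_fun D g -> (forall x, D x -> (0 <= g x)%E) ->
  (\int[density_prob f]_(x in D) g x = \int[m]_(x in D) (g x * (f x)%:E))%E.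
Proof.
move=> mg g0; have mD := density_dom f.
have mf : measurable_fun D (EFin \o f).
  by apply/measurable_EFinP; exact: density_measurable.
have f0 x : D x -> (0 <= (f x)%:E)%E by move=> Dx; rewrite lee_fin density_ge0.
pose h := nnsfun_approx mD mg.
have -> : (\int[density_prob f]_(x in D) g x =
    lim (\int[density_prob f]_(x in D) (EFin \o h n) x @[n --> \oo]))%E.
  have gE x : D x -> g x = lim ((EFin \o h n) x @[n --> \oo]).
    by move=> Dx; apply/esym/cvg_lim => //; exact: cvg_nnsfun_approx.
  under eq_integral => x /[!inE] /gE -> //.
  apply: monotone_convergence => //.
  - move=> n; apply/measurable_EFinP.
    by apply: (measurable_funS measurableT) => //; exact/measurable_funP.
  - by move=> n x Dx //=; rewrite lee_fin.
  - by move=> x Dx a b ab; rewrite lee_fin; exact/lefP/nd_nnsfun_approx.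
have -> : (\int[m]_(x in D) (g x * (f x)%:E) =
    lim (\int[m]_(x in D) ((EFin \o h n) \* (EFin \o f)) x @[n --> \oo]))%E.
  have gE x : D x ->
      (g x * (f x)%:E)%E = lim (((EFin \o h n) \* (EFin \o f))%E x @[n --> \oo]).
    move=> Dx; apply/esym/cvg_lim => //; apply: cvgeZr => //.
    exact: cvg_nnsfun_approx.
  under eq_integral => x /[!inE] /gE -> //.
  apply: monotone_convergence => [//| | |].
  - move=> n; apply/emeasurable_funM => //; apply/measurable_funTS.
    exact/measurable_EFinP.
  - by move=> n x Dx /=; rewrite mule_ge0 ?lee_fin ?f0// -lee_fin f0.
  - move=> x Dx a b ab/=; rewrite lee_wpmul2r ?f0 ?lee_fin//.
    exact/lefP/nd_nnsfun_approx.
suff suf n : (\int[m]_(x in D) ((EFin \o h n) x * (EFin \o f) x) =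
    \int[density_prob f]_(x in D) (EFin \o h n) x)%E.
  by under [in RHS]eq_fun do rewrite suf.
transitivity (\int[density_prob f]_(x in D)
   (\sum_(y \in range (h n)) (y * \1_(h n @^-1` [set y]) x)%:E))%E; last first.
  by apply: eq_integral => t tD; rewrite /= fimfunE -fsumEFin.
have indich p r : measurable_fun D (fun x => (r * \1_(h p @^-1` [set r]) x)%:E).
  by apply: (measurable_comp measurableT) => //; exact: measurable_funM.
rewrite ge0_integral_fsum//; last by move=> p y Dy; exact: nnfun_muleindic_ge0.
transitivity (\int[m]_(x in D) (\sum_(y \in range (h n))
    (y * \1_(h n @^-1` [set y]) x)%:E * (EFin \o f) x))%E.
  under [RHS]eq_integral => x xD.
    rewrite -ge0_mule_fsuml => [|y]; last exact: nnfun_muleindic_ge0.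
    rewrite fsumEFin // -(fimfunE _ x); over.
  by [].
rewrite ge0_integral_fsum//; last 2 first.
  - by move=> y; exact: emeasurable_funM.
  - by move=> p y Dy; rewrite mule_ge0 ?f0// nnfun_muleindic_ge0.
apply: eq_fsbigr => r rhn.
under [RHS]eq_integral do rewrite EFinM.
rewrite integralZl_indic_nnsfun => //.
under eq_integral do rewrite EFinM -muleA.
rewrite ge0_integralZl//.
- rewrite integral_indic//.
  under eq_integral do rewrite muleC.
  rewrite (eq_integral ((EFin \o f) \_ (h n @^-1` [set r]))); last first.
    by move=> x xD; rewrite epatch_indic.
  rewrite -integral_mkcondr.
  (* [density_prob] intersects with D once more, hence the idempotence of the intersection. *)
  congr (_ * _)%E; rewrite setIC.
  by rewrite -[RHS]/(\int[m]_(x in _ `&` D `&` D) _)%E -setIA setIid.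
- by apply: emeasurable_funM => //; exact/measurable_EFinP.
- by move=> t Dt; rewrite mule_ge0 ?lee_fin ?f0// -lee_fin f0.
- by move: rhn; rewrite inE => -[t _ <-]; rewrite lee_fin.
Qed.

(** Multiplication by f x >= 0 commutes with taking positive and negative parts, so the nonnegative
    case applies to each part. *)
Lemma Rintegral_density (g : T -> R) : measurable_fun D g ->
  \int[density_prob f]_(x in D) g x = \int[m]_(x in D) (g x * f x).
Proof.
move=> mg; congr fine; have mEg : measurable_fun D (EFin \o g).
  exact/measurable_EFinP.
rewrite integralE [RHS]integralE !ge0_integral_density//; last 2 first.
  exact: measurable_funeneg.
  exact: measurable_funepos.
congr (_ - _)%E; apply: eq_integral => x /[!inE] Dx;
  have := density_ge0 f Dx; set c := (f x).
- move=> c0; rewrite funeposE [RHS]funeposE -!EFin_max -EFinM; congr EFin.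
  by rewrite maxr_pMl// mul0r.
- move=> c0; rewrite funenegE [RHS]funenegE -!EFin_max -EFinM; congr EFin.
  by rewrite maxr_pMl// mul0r mulNr.
Qed.

Lemma integrable_density_mul (g : T -> R) (M : R) : measurable_fun D g ->
  (forall x, D x -> `|g x| <= M) ->
  m.-integrable D (EFin \o (fun x => g x * f x)).
Proof.
move=> mg gM; have mD := density_dom f.
have mf := density_measurable f.
apply: (@le_integrable _ _ _ _ _ mD _ (fun x => (M * f x)%:E)).
- by apply/measurable_EFinP; exact: measurable_funM.
- move=> x Dx /=; have M0 : 0 <= M := le_trans (normr_ge0 _) (gM _ Dx).
  rewrite lee_fin !normrM (ger0_norm (density_ge0 f Dx)) (ger0_norm M0).
  by rewrite ler_wpM2r ?(density_ge0 f Dx) ?gM.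
- apply/integrableP; split.
    by apply/measurable_EFinP; exact: measurable_funM.
  under eq_integral => x /[!inE] Dx do
    rewrite /= normrM (ger0_norm (density_ge0 f Dx)) EFinM.
  rewrite ge0_integralZl ?density_integral ?lee_fin//.
  + by rewrite mule1 ltry.
  + exact/measurable_EFinP.
  + by move=> x Dx; rewrite lee_fin density_ge0.
Qed.

End density_change.

(** * Affine changes of variable on the line *)

Section affine_change.
Context {R : realType}.
Local Notation leb := (@lebesgue_measure R).

(** The right side is a scaled push-forward of Lebesgue measure; it has the right value on the
    intervals []u, v]], and these determine the measure. *)
Lemma lebesgue_measure_affine (a b : R) (A : set R) : 0 < a -> measurable A ->
  leb A = (a%:E * leb ((fun x : R => (a * x + b)%R) @^-1` A))%E.
Proof.
move=> a0 mA; pose phi : measurableTypeR R -> measurableTypeR R :=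
  fun x => a * x + b.
have mphi : measurable_fun setT phi.
  by apply: measurable_funD => //; exact: measurable_funM.
pose image : {measure set (measurableTypeR R) -> \bar R} :=
  pushforward leb phi.
pose nu : {measure set (measurableTypeR R) -> \bar R} :=
  mscale (NngNum (ltW a0)) (image mphi).
rewrite -[RHS]/(nu A); apply: lebesgue_measure_unique => // _ [[u v]] _ <-.
rewrite -[RHS]/(a%:E * leb (phi @^-1` `]u, v]))%E.
have -> : phi @^-1` `]u, v] = `](u - b) / a, (v - b) / a]%classic.
  apply/seteqP; split => x /=; rewrite !in_itv/= /phi;
    rewrite ltr_pdivrMr// ler_pdivlMr// ltrBlDr lerBrDr (mulrC x)//.
rewrite !lebesgue_measure_itv/= !lte_fin ltr_pM2r ?invr_gt0// ltrD2r.
case: ifP => _; last by rewrite mule0.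
by rewrite -!EFinB -EFinM; congr EFin; field; rewrite gt_eqF.
Qed.

Lemma ge0_integral_affine (a b : R) (f : R -> \bar R) : 0 < a ->
  measurable_fun setT f -> (forall x, (0 <= f x)%E) ->
  (\int[leb]_x f x = a%:E * \int[leb]_x f (a * x + b)%R)%E.
Proof.
move=> a0 mf f0; pose phi : measurableTypeR R -> measurableTypeR R :=
  fun x => a * x + b.
have mphi : measurable_fun setT phi.
  by apply: measurable_funD => //; exact: measurable_funM.
pose image : {measure set (measurableTypeR R) -> \bar R} :=
  pushforward leb phi.
rewrite -[X in (a%:E * X)%E]/(\int[leb]_(x in phi @^-1` setT) (f \o phi) x)%E.
rewrite -ge0_integral_pushforward//.
rewrite -(@ge0_integral_mscale _ _ _ (image mphi) _ _ (NngNum (ltW a0)))//.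
by apply: eq_measure_integral => A mA _; exact: lebesgue_measure_affine.
Qed.

Lemma ge0_integral_scale_halfline (s : R) (f : R -> \bar R) : 0 < s ->
  measurable_fun (@halfline R) f ->
  (forall x, halfline x -> (0 <= f x)%E) ->
  (\int[leb]_(x in @halfline R) f x =
   s%:E * \int[leb]_(a in @halfline R) f (s * a)%R)%E.
Proof.
move=> s0 mf f0.
have mH : measurable (@halfline R) by exact: measurable_itv.
rewrite integral_mkcond (@ge0_integral_affine s 0)//; last 2 first.
  exact/(measurable_restrictT f mH).
  by move=> x; rewrite patchE; case: ifPn => // /set_mem; exact: f0.
congr (_ * _)%E; rewrite [RHS]integral_mkcond; apply: eq_integral => a _.
rewrite !patchE addr0; congr (if _ then _ else _).
apply/idP/idP => /set_mem; rewrite /halfline/= in_itv/= andbT => h;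
  by apply/mem_set; rewrite /halfline/= in_itv/= andbT pmulr_rge0// in h *.
Qed.

Lemma negligible_affine (a b : R) (P : set R) : 0 < a ->
  {ae leb, forall x, P x} -> {ae leb, forall x, P (a * x + b)}.
Proof.
move=> a0 [N [mN N0 sub]].
exists ((fun x => a * x + b) @^-1` N); split.
- rewrite -[X in measurable X]setTI.
  have : measurable_fun setT (fun x : R => a * x + b).
    by apply: measurable_funD => //; exact: measurable_funM.
  by apply.
- have := @lebesgue_measure_affine a b N a0 mN; rewrite N0 => /esym/eqP.
  by rewrite mule_eq0 eqe gt_eqF//= => /eqP.
- by move=> x /= nPx; exact: sub.
Qed.

Lemma negligible_opp (P : set R) :
  {ae leb, forall x, P x} -> {ae leb, forall x, P (- x)}.
Proof.
move=> [N [mN N0 sub]]; exists (-%R @^-1` N); split.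
- rewrite -[X in measurable X]setTI.
  by have : measurable_fun setT (-%R : R -> R) by []; apply.
- exact: etrans (lebesgue_measureN mN) N0.
- by move=> x /= nPx; exact: sub.
Qed.

End affine_change.

(** * The substitution x = a s, y = (1 - a) s *)

Section polar.
Context {R : realType}.
Local Notation leb := (@lebesgue_measure R).
Local Notation leb2 := (leb \x leb)%E.

Lemma ae_neq (c : R) : {ae leb, forall x : R, x != c}.
Proof.
exists [set c]; split => //; first exact: lebesgue_measure_set1.
by move=> x /= /negP/negPn/eqP.
Qed.

(* The pull-back of [f] under [(s, a) |-> (a s, (1 - a) s)], times the
   Jacobian; the truncation of [s] discards the half plane [s <= 0]. *)
Definition polar (f : R * R -> R) (z : R * R) : R :=
  Num.max 0 z.1 * f (z.2 * z.1, (1 - z.2) * z.1).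

Lemma measurable_polar f : measurable_fun setT f ->
  measurable_fun setT (polar f).
Proof.
move=> mf; apply: measurable_funM.
  by apply: measurable_maxr => //; exact: measurable_fst.
apply: (measurableT_comp mf); apply/measurable_fun_pairP; split => /=.
  by apply: measurable_funM; [exact: measurable_snd|exact: measurable_fst].
apply: measurable_funM; last exact: measurable_fst.
by apply: measurable_funB => //; exact: measurable_snd.
Qed.

(** Two one-dimensional affine changes around an exchange of integrals: y = s - x for fixed x, then
    x = s a for fixed s. The second one produces the Jacobian s. *)
Lemma ge0_integral_polar (f : R * R -> R) :
  measurable_fun setT f -> (forall z, 0 <= f z) ->
  (forall z, ~ quadrant z -> f z = 0) ->
  (\int[leb2]_z (f z)%:E = \int[leb2]_z (polar f z)%:E)%E.
Proof.
move=> mf f0 fq.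
have mEf : measurable_fun setT (EFin \o f) by exact/measurable_EFinP.
pose g (z : R * R) : R := f (z.1, z.2 - z.1).
have mg : measurable_fun setT (EFin \o g).
  apply/measurable_EFinP/(measurableT_comp mf)/measurable_fun_pairP.
  split => /=; first exact: measurable_fst.
  by apply: measurable_funB; [exact: measurable_snd|exact: measurable_fst].
have mp : measurable_fun setT (EFin \o polar f).
  by apply/measurable_EFinP; exact: measurable_polar.
have p0 z : (0 <= (polar f z)%:E)%E by rewrite lee_fin mulr_ge0// le_max lexx.
rewrite [LHS]fubini_tonelli1//.
transitivity (\int[leb]_x \int[leb]_s (g (x, s))%:E)%E.
  apply: eq_integral => x _; rewrite /fubini_F.
  rewrite (@ge0_integral_affine _ 1 (- x) (fun y => (f (x, y))%:E))//; last 2 first.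
    exact: (@measurable_fun_pair2 _ _ _ R R _ (EFin \o f) x mEf).
    by move=> y; rewrite lee_fin.
  by rewrite mul1e; apply: eq_integral => s _; rewrite /g/= mul1r.
rewrite -[LHS]/(\int[leb]_x fubini_F leb (EFin \o g) x)%E.
rewrite fubini_tonelli//.
rewrite fubini_tonelli1//.
apply: ge0_ae_eq_integral => //.
- by apply: (@measurable_fun_fubini_tonelli_G _ _ _ _ _ leb _ mg) => z; rewrite lee_fin /g.
- by apply: (@measurable_fun_fubini_tonelli_F _ _ _ _ _ leb _ mp).
- by move=> s _; apply: integral_ge0 => x _; rewrite lee_fin /g.
- by move=> s _; apply: integral_ge0 => a _; exact: p0.
- apply: aeS (ae_neq 0) => s s_neq0 _; rewrite /fubini_F /fubini_G/=.
  have [s0|s0|s0] := ltgtP 0 s; last by rewrite -s0 eqxx in s_neq0.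
  - rewrite (@ge0_integral_affine _ s 0 (fun x => (g (x, s))%:E))//; last 2 first.
      exact: (@measurable_fun_pair1 _ _ _ R R _ (EFin \o g) s mg).
      by move=> y; rewrite lee_fin /g.
    rewrite -ge0_integralZl//.
    + apply: eq_integral => a _; rewrite /g /polar/= max_r ?ltW// -EFinM.
      by rewrite addr0 (mulrC s a) mulrBl mul1r.
    + apply: measurableT_comp => //; apply: (measurableT_comp mf).
      apply/measurable_fun_pairP; split => /=.
        by apply: measurable_funD => //; exact: measurable_funM.
      by apply: measurable_funB => //; apply: measurable_funD => //; exact: measurable_funM.
    + by move=> x _; rewrite lee_fin /g.
    + by rewrite lee_fin ltW.
  (* For s < 0 the points x and s - x are not both nonnegative, so f vanishes, and [polar] vanishes
     by truncation. *)
  - rewrite integral0_eq; last first.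
      move=> x _; rewrite /g fq//= => -[].
      rewrite /halfline/= !in_itv/= !andbT => x0.
      by rewrite subr_ge0 leNgt (lt_le_trans s0).
    by rewrite integral0_eq// => a _; rewrite /polar/= max_l ?mul0r// ltW.
- by move=> z; rewrite lee_fin /g.
Qed.

End polar.

(** * Disintegration along the segments x + y = s *)

Section radial.
Context {R : realType}.
Local Notation leb := (@lebesgue_measure R).
Local Notation leb2 := (leb \x leb)%E.

Definition posline : set (measurableTypeR R) := `]0, +oo[%classic.

Lemma measurable_posline : measurable posline.
Proof. exact: measurable_itv. Qed.

Lemma measurable_unit_itv : measurable (@unit_itv R).
Proof. exact: measurable_itv. Qed.

(** The factor s is the Jacobian, so that the integral of [radial f] over s > 0 is the integral of f
    over the quadrant. *)
Definition radial (f : R * R -> R) (s : R) : R :=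
  \int[leb]_(a in @unit_itv R) (s * f (a * s, (1 - a) * s)).

Lemma quadrant_polar (s a : R) : 0 < s ->
  ((a * s, (1 - a) * s) \in @quadrant R) = (a \in @unit_itv R).
Proof.
move=> s0; apply/idP/idP => /set_mem h; apply/mem_set; move: h;
  rewrite /quadrant /unit_itv /halfline/= !in_itv/= ?andbT.
  by move=> []; rewrite !pmulr_lge0// subr_ge0 => -> ->.
by move=> /andP[a0 a1]; rewrite !pmulr_lge0// subr_ge0.
Qed.

Lemma polar_restrict (f : R * R -> R) (s : R) : 0 < s ->
  (fun a => polar (f \_ (@quadrant R)) (s, a)) =
  (fun a => s * f (a * s, (1 - a) * s)) \_ (@unit_itv R).
Proof.
move=> s0; apply/funext => a; rewrite /polar/= max_r ?ltW// !patchE.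
by rewrite quadrant_polar//; case: ifP; rewrite ?mulr0.
Qed.

Section integrable.
Variable f : R * R -> R.
Hypothesis intf : leb2.-integrable (@quadrant R) (EFin \o f).

Let g := f \_ (@quadrant R).

Let mg : measurable_fun setT g.
Proof.
apply/(measurable_restrictT _ (@measurable_quadrant R)).
by have /integrableP[/measurable_EFinP] := intf.
Qed.

Let gq z : ~ quadrant z -> g z = 0.
Proof. by move=> nqz; rewrite /g patchE memNset. Qed.

Let integral_polar_norm :
  (\int[leb2]_z `|(polar g z)%:E| = \int[leb2]_(z in @quadrant R) `|(f z)%:E|)%E.
Proof.
transitivity (\int[leb2]_z (polar (Num.norm \o g) z)%:E)%E.
  by apply: eq_integral => z _; rewrite /= /polar normrM ger0_norm// le_max lexx.
rewrite -ge0_integral_polar.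
- rewrite [RHS]integral_mkcond; apply: eq_integral => z _.
  by rewrite /= /g !patchE; case: ifP; rewrite ?normr0.
- exact: measurableT_comp.
- by move=> z /=.
- by move=> z nqz /=; rewrite gq// normr0.
Qed.

Lemma integrable_polar : leb2.-integrable setT (EFin \o polar g).
Proof.
apply/integrableP; split.
  by apply/measurable_EFinP; exact: measurable_polar.
rewrite [ltLHS]integral_polar_norm.
by have /integrableP[] := intf.
Qed.

Lemma integral_polar :
  (\int[leb2]_(z in @quadrant R) (f z)%:E = \int[leb2]_z (polar g z)%:E)%E.
Proof.
have -> : (\int[leb2]_(z in @quadrant R) (f z)%:E = \int[leb2]_z (g z)%:E)%E.
  rewrite integral_mkcond; apply: eq_integral => z _.
  by rewrite /g !patchE; case: ifP.
rewrite integralE [RHS]integralE; congr (_ - _)%E.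
- transitivity (\int[leb2]_z (Num.max (g z) 0)%:E)%E.
    by apply: eq_integral => z _; rewrite funeposE/= EFin_max.
  rewrite ge0_integral_polar.
  + apply: eq_integral => z _; rewrite funeposE/= -EFin_max; congr EFin.
    by rewrite /polar maxr_pMr ?le_max ?lexx// mulr0.
  + exact: measurable_maxr.
  + by move=> z; rewrite le_max lexx orbT.
  + by move=> z nqz; rewrite gq// maxxx.
- transitivity (\int[leb2]_z (Num.max (- g z) 0)%:E)%E.
    by apply: eq_integral => z _; rewrite funenegE/= EFin_max.
  rewrite ge0_integral_polar.
  + apply: eq_integral => z _; rewrite funenegE/= -EFin_max; congr EFin.
    by rewrite /polar maxr_pMr ?le_max ?lexx// mulr0 mulrN.
  + by apply: measurable_maxr => //; exact: measurableT_comp.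
  + by move=> z; rewrite le_max lexx orbT.
  + by move=> z nqz; rewrite gq// oppr0 maxxx.
Qed.

(** Fubini gives the integrability of the slice multiplied by s; the factor s > 0 is then divided
    out. *)
Lemma ae_integrable_radial : {ae leb, forall s : R, 0 < s ->
  leb.-integrable (@unit_itv R) (EFin \o (fun a => f (a * s, (1 - a) * s)))}.
Proof.
apply: aeS (ae_integrable1 integrable_polar) => s /= h s0.
have {}h : leb.-integrable setT
    (EFin \o ((fun a => s * f (a * s, (1 - a) * s)) \_ (@unit_itv R))).
  by rewrite -polar_restrict.
have {h} : leb.-integrable (@unit_itv R)
    (EFin \o (fun a => s * f (a * s, (1 - a) * s))).
  apply/(integrable_mkcond _ measurable_unit_itv).
  by rewrite -restrict_EFin in h.
move=> /(integrableZl measurable_unit_itv s^-1); apply: eq_integrable => //.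
  exact: measurable_unit_itv.
by move=> a _ /=; rewrite -EFinM mulKf// gt_eqF.
Qed.

Lemma fubini_polar (s : R) : 0 < s ->
  fine (\int[leb]_a (polar g (s, a))%:E)%E = radial f s.
Proof.
move=> s0; rewrite /radial Rintegral_mkcond /Rintegral -polar_restrict//.
Qed.

Lemma fubini_polar0 (s : R) : s <= 0 ->
  (\int[leb]_a (polar g (s, a))%:E = 0)%E.
Proof. by move=> s0; apply: integral0_eq => a _; rewrite /polar/= max_l ?mul0r. Qed.

Let intF := integrable_fubini_F integrable_polar.

(** [radial] is real-valued, so for s > 0 it can match the extended-real inner integral only where
    the latter is finite; integrability ensures this for almost every s. *)
Lemma ae_fubini_polar :
  {ae leb, forall s, (\int[leb]_a (polar g (s, a))%:E)%E =
    ((EFin \o radial f) \_ posline) s}.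
Proof.
apply: aeS (ae_integrable1 integrable_polar) => s /= h; rewrite patchE.
case: ifPn => [/set_mem|/negP nps].
  rewrite /posline/= in_itv/= andbT => s0.
  by rewrite /= -fubini_polar// fineK//; exact: integrable_fin_num.
rewrite fubini_polar0// leNgt; apply/negP => s0; apply: nps; apply/mem_set.
by rewrite /posline/= in_itv/= s0.
Qed.

Let measurable_radial : measurable_fun posline (radial f).
Proof.
have : measurable_fun posline
    (fine \o (fun s => \int[leb]_a (polar g (s, a))%:E)%E).
  apply: measurableT_comp => //; apply: measurable_funTS.
  exact: measurable_int intF.
apply: eq_measurable_fun => s /set_mem.
by rewrite /posline/= in_itv/= andbT => s0; exact: fubini_polar.
Qed.

Lemma integrable_radial : leb.-integrable posline (EFin \o radial f).
Proof.
apply/(integrable_mkcond _ measurable_posline).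
apply/integrableP; split.
  apply/(measurable_restrictT _ measurable_posline).
  exact/measurable_EFinP.
have /integrableP[mF] := intF.
congr (_ < _)%E; apply: ae_eq_integral => //.
- exact: measurableT_comp.
- apply: measurableT_comp => //.
  apply/(measurable_restrictT _ measurable_posline).
  exact/measurable_EFinP.
- by apply: aeS ae_fubini_polar => s sE _; rewrite -sE.
Qed.

Lemma Rintegral_radial :
  \int[leb2]_(z in @quadrant R) f z = \int[leb]_(s in posline) radial f s.
Proof.
congr fine; rewrite integral_polar -integral12_prod_meas1; last first.
  exact: integrable_polar.
rewrite [RHS]integral_mkcond; apply: ae_eq_integral => //.
- exact: measurable_int intF.
- apply/(measurable_restrictT _ measurable_posline).
  exact/measurable_EFinP.
- by apply: aeS ae_fubini_polar => s sE _; rewrite -sE.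
Qed.

End integrable.
End radial.

(** * Uniqueness from a Laplace transform known on a lattice *)

Section laplace_unique.
Context {R : realType}.
Local Notation leb := (@lebesgue_measure R).
Local Notation H := (@halfline R).

Lemma measurable_halfline : measurable H.
Proof. exact: measurable_itv. Qed.

(** A bound uniform in n, used to dominate the partial sums of an exponential series under the
    integral. *)
Lemma norm_series_exp_coeff (y : R) n :
  `|series (exp_coeff y) n| <= expR `|y|.
Proof.
rewrite /series/= (le_trans (ler_norm_sum _ _ _))//.
have -> : \sum_(0 <= i < n) `|exp_coeff y i| = series (exp_coeff `|y|) n.
  by apply: eq_bigr => i _; rewrite /exp_coeff/= normrM normfV normrX normr_nat.
apply: nondecreasing_cvgn_le; last exact: is_cvg_series_exp_coeff.
apply: nondecreasing_series => i _ _.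
by rewrite /exp_coeff/= mulr_ge0// exprn_ge0.
Qed.

Lemma Rdominated_convergence0 (D : set (measurableTypeR R)) (f_ : nat -> R -> R)
    (f g : R -> R) : measurable D ->
  (forall n, measurable_fun D (f_ n)) -> measurable_fun D f ->
  {ae leb, forall x, D x -> f_ n x @[n --> \oo] --> f x} ->
  leb.-integrable D (EFin \o g) ->
  (forall x n, D x -> `|f_ n x| <= g x) ->
  (forall n, \int[leb]_(x in D) f_ n x = 0) ->
  \int[leb]_(x in D) f x = 0.
Proof.
move=> mD mf_ mf cf ig bd f0.
have [intf _] := @dominated_convergence _ _ _ leb D mD
  (fun n => EFin \o f_ n) (EFin \o f) (EFin \o g)
  (fun n => (measurable_EFinP _ _).2 (mf_ n)) ((measurable_EFinP _ _).2 mf)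
  ltac:(by apply: aeS cf => x h Dx; apply: cvg_EFin; [exact: nearW|exact: h])
  ig ltac:(by apply/aeW => x n Dx; rewrite lee_fin; exact: bd).
rewrite -[X in _ --> X](fineK (integrable_fin_num mD intf)).
move=> /fine_cvgP[_] cu; rewrite /Rintegral -(cvg_lim _ cu)//.
rewrite [X in lim (X @ _)](_ : _ = fun=> 0) ?lim_cst//.
by apply/funext => n; exact: f0.
Qed.

Variables (h : R -> R) (c : R).
Hypotheses (c0 : 0 < c) (inth : leb.-integrable H (EFin \o h)).
Hypothesis lap0 : forall n : nat,
  \int[leb]_(x in H) (h x * expR (- (n%:R * (c * x)))) = 0.

Let mh : measurable_fun H h.
Proof. by have /integrableP[/measurable_EFinP] := inth. Qed.

Let mexp (a : R) : measurable_fun H (fun x => expR (- (a * (c * x)))).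
Proof.
apply: measurable_funTS; apply: measurableT_comp => //.
by apply: measurableT_comp => //; do 2 apply: measurable_funM => //.
Qed.

Let int_mul_bounded (g : R -> R) (M : R) : measurable_fun H g ->
  (forall x, H x -> `|g x| <= M) -> leb.-integrable H (EFin \o (fun x => h x * g x)).
Proof.
move=> mg gM; have := @integrableMl _ _ _ leb H measurable_halfline (EFin \o h) g inth mg.
apply; exists M; split; first exact: num_real.
by move=> r Mr x Hx; exact: le_trans (gM _ Hx) (ltW Mr).
Qed.

(** In the exponential series of exp (- M exp (- k c x)) the i-th term is a multiple of exp (- (k i)
    c x), again a lattice exponential; every term integrates to zero against h, and the partial sums
    are dominated by exp M. *)
Let laplace_exp (M : R) (k : nat) : 0 <= M ->
  \int[leb]_(x in H) (h x * expR (- (M * expR (- (k%:R * (c * x)))))) = 0.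
Proof.
move=> M0; set y := fun x : R => - (M * expR (- (k%:R * (c * x)))).
have my : measurable_fun H y.
  by apply: measurableT_comp => //; apply: measurable_funM => //; exact: mexp.
have yM x : H x -> `|y x| <= M.
  rewrite /halfline/= in_itv/= andbT => x0.
  rewrite /y normrN ger0_norm ?mulr_ge0 ?expR_ge0// ler_piMr//.
  by rewrite expR_le1 oppr_le0 !mulr_ge0// ltW.
apply: (@Rdominated_convergence0 _ (fun n x => h x * series (exp_coeff (y x)) n)
  _ (fun x => `|h x| * expR M)).
- exact: measurable_halfline.
- move=> n; apply: measurable_funM => //; rewrite /series/=.
  apply: measurable_sum => i; rewrite /exp_coeff/=.
  by apply: measurable_funM => //; exact: measurable_funX.
- by apply: measurable_funM => //; exact: measurableT_comp.
- apply/aeW => x Hx; apply: cvgMr; exact: is_cvg_series_exp_coeff.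
- have := integrable_norm inth.
  move=> /(integrableZr measurable_halfline (expR M)).
  by apply: eq_integrable => //; exact: measurable_halfline.
- move=> x n Hx; rewrite normrM ler_wpM2l//.
  by rewrite (le_trans (norm_series_exp_coeff _ _))// ler_expR yM.
- move=> n; pose u (i : nat) (x : R) :=
    (i`!%:R^-1 * (- M) ^+ i) * (h x * expR (- ((k * i)%:R * (c * x)))).
  transitivity (\int[leb]_(x in H) \sum_(0 <= i < n) u i x).
    apply: eq_Rintegral => x _; rewrite /series/= mulr_sumr.
    apply: eq_bigr => i _; rewrite /exp_coeff/= /u /y -mulNr exprMn.
    rewrite -expRM_natr natrM; set E1 := expR _; set E2 := expR _.
    have -> : E1 = E2 by congr expR; ring.
    ring.
  have intu i : leb.-integrable H (EFin \o u i).
    have := integrableZl measurable_halfline (i`!%:R^-1 * (- M) ^+ i)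
      (@int_mul_bounded _ 1 (mexp (k * i)%:R) _).
    apply=> x; rewrite /halfline/= in_itv/= andbT => x0.
    by rewrite ger0_norm ?expR_ge0// expR_le1 oppr_le0 !mulr_ge0// ltW.
  elim: n => [|n IH].
    by under eq_Rintegral do rewrite big_nil; rewrite /Rintegral integral0.
  under eq_Rintegral do rewrite big_nat_recr//=.
  rewrite RintegralD ?IH ?add0r//.
  + rewrite RintegralZl ?lap0 ?mulr0//; first exact: measurable_halfline.
    apply: (@int_mul_bounded _ 1) => // x.
    rewrite /halfline/= in_itv/= andbT => x0.
    by rewrite ger0_norm ?expR_ge0// expR_le1 oppr_le0 !mulr_ge0// ltW.
  + exact: measurable_halfline.
  + rewrite (_ : _ \o _ = (fun x => \sum_(0 <= i < n) (EFin \o u i) x)%E).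
      by apply: integrable_sum => //; exact: measurable_halfline.
    by apply/funext => x; rewrite /= sumEFin.
Qed.

(* [exp (- exp (k c (x0 - x)))] tends to the indicator of [x > x0]. *)
Let integral_gt (x0 : R) : \int[leb]_(x in H) (h x * (x0 < x)%R%:R) = 0.
Proof.
apply: (@Rdominated_convergence0 _
  (fun k x => h x * expR (- (expR (k%:R * (c * x0)) * expR (- (k%:R * (c * x))))))
  _ (fun x => `|h x|)).
- exact: measurable_halfline.
- move=> n; apply: measurable_funM => //.
  apply: measurableT_comp => //.
  by apply: measurableT_comp => //; apply: measurable_funM => //; exact: mexp.
- apply: measurable_funM => //.
  apply: measurable_funTS; rewrite (_ : (fun _ => _) = \1_(`]x0, +oo[%classic)).
    by apply: measurable_indic; exact: measurable_itv.
  by apply/funext => x; rewrite indicE mem_setE in_itv/= andbT.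
(* The point x0 is set aside: there the double exponential is constantly [expR (- 1)], which is not
   the value of the indicator. *)
- apply: aeS (ae_neq x0) => x xx0 _; apply: cvgMr.
  have cE k : expR (k%:R * (c * x0)) * expR (- (k%:R * (c * x))) =
      expR ((c * (x0 - x)) * k%:R).
    by rewrite -expRD; congr expR; ring.
  under eq_fun do rewrite cE.
  have cnat (d : R) : 0 < d -> d * k%:R @[k --> \oo] --> +oo.
    move=> d0; apply/cvgryPge => A; have /cvgryPge/(_ (A / d)) := @cvgr_idn R.
    by apply: filterS => k; rewrite ler_pdivrMr// mulrC.
  have [x0x|xltx0|xE] := ltgtP x0 x; last by rewrite xE eqxx in xx0.
  + suff : expR (- expR (c * (x0 - x) * k%:R)) @[k --> \oo] --> expR (- 0).
      by rewrite oppr0 expR0.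
    apply: continuous_cvg; first exact: continuous_expR.
    apply: cvgN.
    under eq_fun do rewrite -[x0 - x]opprB mulrN mulNr.
    have d0 : 0 < c * (x - x0) by rewrite mulr_gt0// subr_gt0.
    exact: (@cvg_comp _ _ _ (fun k : nat => c * (x - x0) * k%:R)
      (fun r => expR (- r)) _ _ _ (cnat _ d0) (@cvgr_expR R)).
  + have d0 : 0 < c * (x0 - x) by rewrite mulr_gt0// subr_gt0.
    apply: (@cvg_comp _ _ _ (fun k : nat => expR (c * (x0 - x) * k%:R))
      (fun r => expR (- r)) _ _ _ _ (@cvgr_expR R)).
    apply/cvgryPge => A; have /cvgryPge/(_ A) := cnat _ d0.
    apply: filterS => k Ak.
    by rewrite (le_trans Ak)// (le_trans _ (expR_ge1Dx _))// lerDr.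
- exact: integrable_norm inth.
- move=> x k Hx; rewrite normrM ler_piMr//.
  by rewrite ger0_norm ?expR_ge0// expR_le1 oppr_le0 mulr_ge0 ?expR_ge0.
(* The constant exp (k c x0) plays the part of M. *)
- by move=> k; apply: laplace_exp; exact: expR_ge0.
Qed.

(** All tail integrals of h vanish, so the primitive of its extension by zero is constantly zero;
    Lebesgue differentiation returns h almost everywhere. *)
Lemma laplace_eq0_ae : {ae leb, forall x, H x -> h x = 0}.
Proof.
pose g := h \_ H.
have intg : leb.-integrable setT (EFin \o g).
  have /(integrable_mkcond _ measurable_halfline) := inth.
  by rewrite restrict_EFin.
(* The lattice point n = 0 gives the total integral; removing a tail from it leaves the
   primitive. *)
have intg0 : \int[leb]_x g x = 0.
  rewrite -Rintegral_mkcond -[RHS](lap0 0); apply: eq_Rintegral => x _.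
  by rewrite mul0r oppr0 expR0 mulr1.
have intgy y : leb.-integrable `]-oo, y] (EFin \o g).
  by apply: integrableS intg => //; exact: measurable_itv.
have F0 y : \int[leb]_(x in `]-oo, y]) g x = 0.
  have : \int[leb]_(x in `]y, +oo[) g x = 0.
    rewrite Rintegral_mkcond -(integral_gt y) [RHS]Rintegral_mkcond.
    apply: eq_Rintegral => x _; rewrite /g !patchE mem_setE in_itv/= andbT.
    by case: ifP; case: ifP; rewrite ?mulr1 ?mulr0.
  have TE : setT = `]-oo, y] `|` `]y, +oo[ :> set R.
    apply/seteqP; split => // x _ /=; rewrite !in_itv/= andbT.
    by case: leP => ?; [left|right].
  have := intg0; rewrite {1}TE Rintegral_setU; last 4 first.
  - exact: measurable_itv.
  - exact: measurable_itv.
  - by rewrite -TE.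
  - apply/disj_setPS => x [] /=; rewrite !in_itv/= andbT => xy.
    by rewrite ltNge xy.
  by move=> + e; rewrite e addr0.
have loc : locally_integrable setT g by apply: open_integrable_locally => //; exact: openT.
apply: aeS (FTC1Ny intgy loc) => x /= [_].
rewrite (_ : (fun _ => _) = cst 0); last by apply/funext => y; exact: F0.
by rewrite derive1_cst /g patchE => + Hx; rewrite mem_set.
Qed.

End laplace_unique.

(** * Measurability and extension of continuous functions on the quadrant *)

Section quadrant_continuous.
Context {R : realType}.
Local Notation leb := (@lebesgue_measure R).
Local Notation E := (@quadrant R).

(** The product sigma-algebra is generated by rectangles, whereas open sets come from the product
    topology. An open set is the union of the countably many boxes with rational centres and radii 1
    / (n + 1) that it contains. *)
Lemma open_measurable_prod (A : set (R * R)) : open A ->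
  measurable (A : set (measurableTypeR R * measurableTypeR R)).
Proof.
move=> oA.
pose F (i : rat * rat * nat) : set (R * R) :=
  ball (ratr i.1.1 : R) i.2.+1%:R^-1 `*` ball (ratr i.1.2 : R) i.2.+1%:R^-1.
have -> : A = \bigcup_i (if `[< F i `<=` A >] then F i else set0).
  apply/seteqP; split => [[x y] Axy|z [i _]]; last first.
    by case: ifP => // /asboolP FA /FA.
  have [e /= e0 eA] : exists2 e : R, 0 < e & ball (x, y) e `<=` A.
    have := oA; rewrite openE => /(_ _ Axy) /nbhs_ballP[e /= e0 eA].
    by exists e.
  have [n ne] : exists n : nat, n.+1%:R^-1 < e / 2.
    exists (Num.truncn (e / 2)^-1); rewrite invf_plt ?posrE ?divr_gt0 ?ltr0n//.
    exact: truncnS_gt.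
  have n0 : (0 : R) < n.+1%:R^-1 by rewrite invr_gt0 ltr0n.
  have ratnear (u : R) : exists q : rat, ball (ratr q : R) n.+1%:R^-1 u.
    have [q] := @rat_in_itvoo R (u - n.+1%:R^-1) (u + n.+1%:R^-1)
      (ltac:(by rewrite ltrBlDr -addrA ltrDl addr_gt0)).
    rewrite in_itv/= => /andP[q1 q2]; exists q.
    by rewrite /ball/= distrC ltr_distl ltrBlDr q2 -ltrBlDr q1.
  have [p px] := ratnear x; have [q qy] := ratnear y.
  exists (p, q, n) => //; rewrite asboolT//.
  move=> [u v] [/= pu qv]; apply: eA; split => /=.
  - apply: (@le_ball _ _ x (n.+1%:R^-1 + n.+1%:R^-1)).
      by rewrite [leRHS]splitr lerD// ltW.
    by apply: ball_triangle pu; exact: ball_sym.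
  - apply: (@le_ball _ _ y (n.+1%:R^-1 + n.+1%:R^-1)).
      by rewrite [leRHS]splitr lerD// ltW.
    by apply: ball_triangle qv; exact: ball_sym.
apply: countable_bigcupT_measurable => // i; case: ifP => // _.
by apply: measurableX; exact: measurable_ball.
Qed.

Lemma continuous_measurable_prod (f : R * R -> R) : continuous f ->
  measurable_fun setT (f : measurableTypeR R * measurableTypeR R -> R).
Proof.
move=> /continuousP cf; apply: (measurability _ (RGenOpens.measurableE R)).
move=> _ [_ [a [b ->] <-]]; rewrite setTI; apply: open_measurable_prod.
exact/cf/interval_open.
Qed.

Lemma continuous_pair (T : topologicalType) (f g : T -> R) (z : T) :
  {for z, continuous f} -> {for z, continuous g} ->
  {for z, continuous (fun w => (f w, g w))}.
Proof.
exact: (@cvg_pair _ _ _ (nbhs z) (nbhs (f z)) (nbhs (g z)) _ _ _ f g).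
Qed.

(** Composition with the retraction of the plane onto the quadrant turns continuity within the
    quadrant into continuity on the plane. *)
Definition quadrant_clamp (f : R * R -> R) (z : R * R) : R :=
  f (Num.max 0 z.1, Num.max 0 z.2).

Lemma quadrant_clampE (f : R * R -> R) z : E z -> quadrant_clamp f z = f z.
Proof.
case: z => x y [] /=; rewrite /halfline/= !in_itv/= !andbT => x0 y0.
by rewrite /quadrant_clamp/= !max_r.
Qed.

Lemma quadrant_max (z : R * R) : E (Num.max 0 z.1, Num.max 0 z.2).
Proof. by split; rewrite /halfline/= in_itv/= andbT le_max lexx. Qed.

Lemma continuous_quadrant_clamp (f : R * R -> R) :
  {within (E : set (R * R)), continuous f} -> continuous (quadrant_clamp f).
Proof.
move=> /subspace_continuousP cf z; rewrite /continuous_at.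
have := cf _ (quadrant_max z); apply: cvg_trans.
move=> P /=; rewrite !nbhs_simpl/= => fP.
pose c (w : R * R) := (Num.max 0 w.1, Num.max 0 w.2).
have cc : {for z, continuous c}.
  have c1 : Num.max 0 w.1 @[w --> z] --> Num.max 0 z.1.
    by apply: (@continuous_max _ _ (cst 0) fst); [exact: cst_continuous|exact: cvg_fst].
  have c2 : Num.max 0 w.2 @[w --> z] --> Num.max 0 z.2.
    by apply: (@continuous_max _ _ (cst 0) snd); [exact: cst_continuous|exact: cvg_snd].
  exact: (@continuous_pair _ (fun w : R * R => Num.max 0 w.1)
    (fun w => Num.max 0 w.2) z c1 c2).
apply: (@filterS _ (nbhs z) _ _ _ _ (cc _ fP)) => w; apply.
exact: quadrant_max.
Qed.

Lemma measurable_within_quadrant (f : R * R -> R) :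
  {within (E : set (R * R)), continuous f} -> measurable_fun E f.
Proof.
move=> cf; have /continuous_measurable_prod := continuous_quadrant_clamp f cf.
move=> /(@measurable_funS _ _ _ _ _ E _ measurableT (@subsetT _ E)).
by apply: eq_measurable_fun => z /set_mem; exact: quadrant_clampE.
Qed.

End quadrant_continuous.

(** * The operator P as a continuous function of s *)

Section redist_mean.
Context {R : realType} (nu : redistribution_measure R).
Local Notation leb := (@lebesgue_measure R).

(** P f at (x, y) depends on s = x + y alone: [redist_op nu f] is this function composed with the
    sum. *)
Definition redist_mean (f : R * R -> R) (s : R) : R :=
  \int[leb]_(e in @unit_itv R) (f (e * s, (1 - e) * s) * nu s e).

Lemma integral_redist_density (s : R) :
  \int[leb]_(e in @unit_itv R) nu s e = 1.
Proof. by rewrite /Rintegral density_integral. Qed.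

Lemma integrable_redist_density (s : R) (g : R -> R) (M : R) :
  measurable_fun (@unit_itv R) g ->
  (forall e, unit_itv e -> `|g e| <= M) ->
  leb.-integrable (@unit_itv R) (EFin \o (fun e => g e * nu s e)).
Proof. exact: integrable_density_mul. Qed.

Lemma norm_integral_redist_le (s : R) (g : R -> R) (M : R) :
  measurable_fun (@unit_itv R) g ->
  (forall e, unit_itv e -> `|g e| <= M) ->
  `|\int[leb]_(e in @unit_itv R) (g e * nu s e)| <= M.
Proof.
move=> mg gM; have ig := integrable_redist_density s g M mg gM.
have mU := @measurable_unit_itv R.
rewrite (le_trans (le_normr_Rintegral mU ig))//.
rewrite -[leRHS]mulr1 -(integral_redist_density s) -RintegralZl//; last first.
  have := @integrable_redist_density s (cst 1) 1 ltac:(by []) ltac:(by rewrite /= normr1).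
  by apply: eq_integrable => // e _ /=; rewrite mul1r.
apply: le_Rintegral => //.
- exact: integrable_norm.
- have := @integrable_redist_density s (cst M) `|M| ltac:(by []) ltac:(by []).
  exact: eq_integrable.
- move=> e Ue; rewrite normrM (ger0_norm (density_ge0 (nu s) Ue)).
  by rewrite ler_wpM2r ?gM// (density_ge0 (nu s) Ue).
Qed.

Variable f : R * R -> R.
Hypothesis bcf : bounded_continuous f.

(** The function f in the coordinates (s, a), clamped so as to be jointly continuous for all real s
    and a. *)
Let Phi (s a : R) : R := quadrant_clamp f (a * s, (1 - a) * s).

Let PhiE s a : 0 <= s -> unit_itv a -> Phi s a = f (a * s, (1 - a) * s).
Proof.
move=> s0; rewrite /unit_itv/= in_itv/= => /andP[a0 a1].
rewrite /Phi quadrant_clampE//; split => /=; rewrite /halfline/= in_itv/= andbT.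
  by rewrite mulr_ge0.
by rewrite mulr_ge0// subr_ge0.
Qed.

Let cPhi : continuous (fun z : R * R => Phi z.1 z.2).
Proof.
move=> z.
have c1 : z.2 * z.1 @[z --> z] --> z.2 * z.1.
  by apply: cvgM; [exact: cvg_snd|exact: cvg_fst].
have c2 : (1 - z.2) * z.1 @[z --> z] --> (1 - z.2) * z.1.
  apply: cvgM; last exact: cvg_fst.
  by apply: cvgB; [exact: cvg_cst|exact: cvg_snd].
have c := @continuous_pair R _ (fun z : R * R => z.2 * z.1)
  (fun z => (1 - z.2) * z.1) z c1 c2.
exact: (continuous_comp c (continuous_quadrant_clamp f bcf.1 _)).
Qed.

Let cPhis s : continuous (Phi s).
Proof.
move=> a.
have c : {for a, continuous (fun a : R => (s, a))}.
  by apply: (@continuous_pair R _ (cst s) id a); [exact: cvg_cst|exact: cvg_id].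
exact: (continuous_comp c (cPhi (s, a))).
Qed.

Let mPhi s : measurable_fun (@unit_itv R) (Phi s).
Proof. by apply: measurable_funTS; apply: continuous_measurable_fun; exact: cPhis. Qed.

(** The continuity in s is uniform in a because [0, 1] is compact. *)
Let near_Phi (s0 e : R) : 0 < e ->
  \forall s \near s0, forall a, unit_itv a -> `|Phi s a - Phi s0 a| < e.
Proof.
move=> e0; have /compact_near_coveringP cU := @segment_compact R 0 1.
have := cU R (nbhs s0) (fun s a => `|Phi s a - Phi s0 a| < e) _.
apply => a _.
have e2 : 0 < e / 2 by rewrite divr_gt0.
have h1 : \forall a' \near a & s \near s0, `|Phi s a' - Phi s0 a| < e / 2.
  have /cvgrPdist_lt/(_ _ e2) := cPhi (s0, a).
  move=> /nbhs_ballP[d /= d0 dP].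
  exists (ball a d, ball s0 d) => /=; first by split; exact: nbhsx_ballx.
  by move=> [a' s] [/= aa' ss']; rewrite distrC; exact: (dP (s, a')).
have h2 : \forall a' \near a & s \near s0, `|Phi s0 a' - Phi s0 a| < e / 2.
  have /cvgrPdist_lt/(_ _ e2) := @cPhis s0 a => h.
  exists ([set a' | `|Phi s0 a' - Phi s0 a| < e / 2], setT) => /=.
    split; last exact: filterT.
    by apply: filterS h => a'; rewrite distrC.
  by move=> [a' s] [].
apply: filterS2 h1 h2 => -[a' s] /= h1 h2.
rewrite (_ : _ - _ = (Phi s a' - Phi s0 a) - (Phi s0 a' - Phi s0 a)); last ring.
by rewrite (le_lt_trans (ler_normB _ _))// [ltRHS]splitr ltrD.
Qed.

Lemma continuous_redist_mean :
  {within `[0, +oo[, continuous (redist_mean f)}.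
Proof.
apply/subspace_continuousP => s0 s00.
have [B bB] := bcf.2.
have PhiB s a : 0 <= s -> unit_itv a -> `|Phi s a| <= B.
  move=> s1 Ua; rewrite /Phi /quadrant_clamp bB//; exact: quadrant_max.
have meanE s : 0 <= s -> redist_mean f s =
    \int[leb]_(a in @unit_itv R) (Phi s a * nu s a).
  by move=> s1; apply: eq_Rintegral => a /set_mem Ua; rewrite PhiE.
have cU : {within `[0, 1], continuous (Phi s0)}.
  by apply: continuous_subspaceT; exact: cPhis.
have /subspace_continuousP/(_ _ s00) := @redist_weak_continuous _ nu _ cU.
have s0ge : 0 <= s0 by move: s00; rewrite /= in_itv/= andbT.
(* The mean with the integrand frozen at s0 and the law still at s. *)
pose u s := \int[leb]_(a in @unit_itv R) (Phi s0 a * nu s a).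
move=> cu0.
have cu : u s @[s --> within `[0, +oo[%classic (nbhs s0)] --> redist_mean f s0.
  by rewrite (meanE s0 s0ge); exact: cu0.
apply/cvgrPdist_lt => e e0; have e2 : 0 < e / 2 by rewrite divr_gt0.
move/cvgrPdist_lt : cu => /(_ _ e2) cu2.
near=> s.
have s1 : 0 <= s.
  have : `[0, +oo[%classic s by near: s; exact: withinT.
  by rewrite /= in_itv/= andbT.
have us : `|redist_mean f s0 - u s| < e / 2 by near: s; exact: cu2.
have Phis a : unit_itv a -> `|Phi s a - Phi s0 a| < e / 2.
  move: a; near: s; apply: cvg_within; exact: near_Phi.
have -> : redist_mean f s0 - redist_mean f s =
  (redist_mean f s0 - u s) - (redist_mean f s - u s) by rewrite opprB addrA subrK.
rewrite (le_lt_trans (ler_normB _ _))// [ltRHS]splitr ltr_leD//.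
rewrite (meanE s)// /u -RintegralB; last 3 first.
- exact: measurable_unit_itv.
- by apply: integrable_redist_density => // a Ua; exact: PhiB.
- by apply: integrable_redist_density => // a Ua; exact: PhiB.
under eq_Rintegral do rewrite -mulrBl.
apply: norm_integral_redist_le; first exact: measurable_funB.
by move=> a Ua; exact/ltW/Phis.
Unshelve. all: by end_near. Qed.

Lemma measurable_redist_mean : measurable_fun (@halfline R) (redist_mean f).
Proof.
apply: subspace_continuous_measurable_fun; first exact: measurable_itv.
exact: continuous_redist_mean.
Qed.

End redist_mean.

(** * Invariance, reversibility and the conditional law on each segment *)

Section invariance.
Context {R : realType} (nu : redistribution_measure R).
Local Notation leb := (@lebesgue_measure R).
Local Notation leb2 := (leb \x leb)%E.
Local Notation U := (@unit_itv R).
Local Notation E := (@quadrant R).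
Variable mu : prob_density leb2 E.

Let slice (s a : R) : R := mu (a * s, (1 - a) * s).

(** The formula for [nu] with the denominator cleared; at D = 0 it says that the slice vanishes
    almost everywhere. Integrability is part of it because a real-valued integral defaults to 0 when
    the true one is infinite. *)
Definition balanced_at (s : R) : Prop :=
  let D := \int[leb]_(a in U) slice s a in
  leb.-integrable U (EFin \o slice s) /\
  {ae leb, forall a, U a -> D * nu s a = slice s a}.

Let slice_ge0 s a : 0 <= s -> U a -> 0 <= slice s a.
Proof.
rewrite /unit_itv/= in_itv/= => s0 /andP[a0 a1]; apply: density_ge0.
split; rewrite /halfline/= in_itv/= andbT; first by rewrite mulr_ge0.
by rewrite mulr_ge0// subr_ge0.
Qed.

(** The density in s of the measure f mu dx dy. *)
Let weight (f : R * R -> R) : R -> R := radial (fun z => f z * mu z).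

Let intdens (f : R * R -> R) (M : R) : measurable_fun E f ->
  (forall z, E z -> `|f z| <= M) ->
  leb2.-integrable E (EFin \o (fun z => f z * mu z)).
Proof. exact: integrable_density_mul. Qed.

Lemma Rintegral_density_radial (f : R * R -> R) (M : R) :
  measurable_fun E f -> (forall z, E z -> `|f z| <= M) ->
  \int[density_prob mu]_(z in E) f z = \int[leb]_(s in posline) weight f s.
Proof.
move=> mf fM; rewrite Rintegral_density// Rintegral_radial//.
exact: intdens fM.
Qed.

Lemma ae_integrable_slice : {ae leb, forall s, 0 < s ->
  leb.-integrable U (EFin \o slice s)}.
Proof.
have int1 := intdens (cst 1) 1 ltac:(by []) ltac:(by rewrite /= normr1).
apply: aeS (ae_integrable_radial _ int1) => s /= h s0; have := h s0.
apply: eq_integrable => //; first exact: measurable_unit_itv.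
by move=> a _ /=; rewrite mul1r.
Qed.

Definition slice_mass (s : R) : R := \int[leb]_(a in U) slice s a.

(** Only D = 0 needs an argument: a nonnegative integrable slice with integral zero vanishes almost
    everywhere, so the cleared equation holds there as well. *)
Lemma balanced_iff :
  {ae leb, forall s, 0 < s -> balanced_at s} <->
  {ae leb, forall s : R, 0 < s ->
     let D := \int[leb]_(al in U) mu (al * s, (1 - al) * s) in
     D != 0 ->
     {ae leb, forall a : R, 0 <= a <= 1 ->
        nu s a = mu (a * s, (1 - a) * s) / D}}.
Proof.
split=> h.
  apply: aeS h => s hs s0 /= D0; have [_] := hs s0.
  apply: aeS => a ha a01; have Ua : U a by rewrite /unit_itv/= in_itv.
  by rewrite -[mu (_, _)]/(slice s a) -(ha Ua) mulrC mulKf.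
apply: aeS (aeI h ae_integrable_slice) => s [{}h hi] s0; split.
  exact: hi.
have [D0|D0] := eqVneq (\int[leb]_(a in U) slice s a) 0; last first.
  apply: aeS (h s0 D0) => a ha; rewrite /unit_itv/= in_itv/= => /ha ->.
  by rewrite mulrC divfK.
have int0 : (\int[leb]_(a in U) `|(slice s a)%:E| = 0)%E.
  rewrite -[RHS]/(0%:E) -D0 /Rintegral fineK; last first.
    by apply: integrable_fin_num (hi s0); exact: measurable_unit_itv.
  apply: eq_integral => a /set_mem Ua.
  by rewrite /= ger0_norm// slice_ge0// ltW.
have /(ae_eq_integral_abs leb measurable_unit_itv) := int0.
have /integrableP[ms _] := hi s0.
move=> /(_ ms); apply: aeS => a ha Ua.
by rewrite D0 mul0r; have [] := ha Ua.
Qed.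

Let slice_quadrant s a : 0 < s -> U a -> E (a * s, (1 - a) * s).
Proof. by move=> s0 Ua; apply/set_mem; rewrite quadrant_polar//; exact: mem_set. Qed.

Let measurable_slice (f : R * R -> R) (s : R) : measurable_fun E f -> 0 < s ->
  measurable_fun U (fun a => f (a * s, (1 - a) * s)).
Proof.
move=> mf s0; apply: (measurable_comp (@measurable_quadrant R) _ mf).
  by move=> _ [a Ua <-]; exact: slice_quadrant.
apply: measurable_funTS; apply/measurable_fun_pairP; split => /=.
  exact: measurable_funM.
by apply: measurable_funM => //; exact: measurable_funB.
Qed.

Section bounded.
Variables (f : R * R -> R) (M : R).
Hypotheses (mf : measurable_fun E f) (fM : forall z, E z -> `|f z| <= M).

(** On a balanced segment mu is its total mass times [nu s], so averaging f against mu is averaging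
    f against [nu s]. *)
Lemma weight_balanced s : 0 < s -> balanced_at s ->
  weight f s = s * slice_mass s * redist_mean nu f s.
Proof.
move=> s0 [intD bal]; rewrite /weight /radial /redist_mean.
rewrite -/(slice_mass s) in bal.
have mU := @measurable_unit_itv R.
have ig := @integrable_density_mul _ _ _ leb U (nu s) _ M (measurable_slice _ s mf s0)
  (fun a Ua => fM _ (slice_quadrant s a s0 Ua)).
rewrite -RintegralZl//; congr fine; apply: ae_eq_integral => //.
- apply/measurable_EFinP; apply: measurable_funM => //.
  apply: measurable_funM; first exact: measurable_slice.
  by have /integrableP[/measurable_EFinP] := intD.
- apply/measurable_EFinP; apply: measurable_funM => //.
  by have /integrableP[/measurable_EFinP] := ig.
- apply: aeS bal => a ha Ua; rewrite -[mu (_, _)]/(slice s a) -(ha Ua).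
  by congr EFin; ring.
Qed.

End bounded.

(** A function of x + y is constant on the segment x + y = s. With [phi] equal to [redist_mean nu f]
    this pulls P f out of the integral. *)
Lemma weight_mul_sum (phi : R -> R) (g : R * R -> R) (s M : R) : 0 < s ->
  leb.-integrable U (EFin \o slice s) ->
  measurable_fun E g -> (forall z, E z -> `|g z| <= M) ->
  weight (fun z => phi (z.1 + z.2) * g z) s = phi s * weight g s.
Proof.
move=> s0 intD mg gM; rewrite /weight /radial.
have sE a : a * s + (1 - a) * s = s by ring.
have ig : leb.-integrable U
    (EFin \o (fun a => s * (g (a * s, (1 - a) * s) * slice s a))).
  have : leb.-integrable U
      ((EFin \o (fun a => (s * g (a * s, (1 - a) * s))%R)) \* (EFin \o slice s))%E.
    apply: integrableMr => //; first exact: measurable_unit_itv.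
    - apply: measurable_funM => //; exact: measurable_slice.
    - exists (s * M); split; first exact: num_real.
      move=> r Mr a Ua /=; apply: (le_trans _ (ltW Mr)).
      rewrite normrM gtr0_norm// ler_pM2l//; apply: gM.
      exact: slice_quadrant.
  apply: eq_integrable => //; first exact: measurable_unit_itv.
  by move=> a _ /=; rewrite -EFinM mulrA.
rewrite -RintegralZl//; last exact: measurable_unit_itv.
by apply: eq_Rintegral => a _; rewrite /= sE /slice; ring.
Qed.

Lemma measurable_redist_op (f : R * R -> R) : bounded_continuous f ->
  measurable_fun E (redist_op nu f).
Proof.
move=> bcf; pose sum (z : R * R) := z.1 + z.2.
rewrite -[redist_op nu f]/(redist_mean nu f \o sum).
apply: (measurable_comp (@measurable_halfline R) _ (measurable_redist_mean nu f bcf)).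
- move=> _ [z [z1 z2] <-]; move: z1 z2; rewrite /halfline/= !in_itv/= !andbT.
  exact: addr_ge0.
- apply: measurable_funTS; apply: measurable_funD; first exact: measurable_fst.
  exact: measurable_snd.
Qed.

Lemma redist_mean_le (f : R * R -> R) (M s : R) :
  bounded_continuous f -> (forall z, E z -> `|f z| <= M) -> 0 <= s ->
  `|redist_mean nu f s| <= M.
Proof.
move=> bcf fM s0.
have s_quad a : U a -> E (a * s, (1 - a) * s).
  rewrite /unit_itv/= in_itv/= => /andP[a0 a1].
  split; rewrite /halfline/= in_itv/= andbT; first by rewrite mulr_ge0.
  by rewrite mulr_ge0// subr_ge0.
apply: norm_integral_redist_le; last by move=> e Ue; apply: fM; exact: s_quad.
apply: (measurable_comp (@measurable_quadrant R) _ (measurable_within_quadrant f bcf.1)).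
  by move=> _ [a Ua <-]; exact: s_quad.
apply: measurable_funTS; apply/measurable_fun_pairP; split => /=.
  exact: measurable_funM.
by apply: measurable_funM => //; exact: measurable_funB.
Qed.

Lemma redist_op_le (f : R * R -> R) (M : R) :
  bounded_continuous f -> (forall z, E z -> `|f z| <= M) ->
  forall z, E z -> `|redist_op nu f z| <= M.
Proof.
move=> bcf fM z [z1 z2]; apply: redist_mean_le => //.
by move: z1 z2; rewrite /halfline/= !in_itv/= !andbT; exact: addr_ge0.
Qed.

Lemma ae_eq_weight (f g : R * R -> R) (M M' : R) :
  measurable_fun E f -> (forall z, E z -> `|f z| <= M) ->
  measurable_fun E g -> (forall z, E z -> `|g z| <= M') ->
  {ae leb, forall s, 0 < s -> weight f s = weight g s} ->
  \int[density_prob mu]_(z in E) f z = \int[density_prob mu]_(z in E) g z.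
Proof.
move=> mf fM mg gM h; rewrite (Rintegral_density_radial f M mf fM).
rewrite (Rintegral_density_radial g M' mg gM); congr fine.
have /integrableP[m1 _] := integrable_radial _ (intdens f M mf fM).
have /integrableP[m2 _] := integrable_radial _ (intdens g M' mg gM).
apply: ae_eq_integral => //; first exact: measurable_posline.
apply: aeS h => s hs; rewrite /posline/= in_itv/= andbT => s0.
by congr EFin; exact: hs.
Qed.

(** As P f depends on s only, the density in s of (P f) g is s D(s) times the product of the
    [nu s]-means of f and g, which is symmetric in f and g. *)
Lemma balanced_reversible :
  {ae leb, forall s, 0 < s -> balanced_at s} ->
  reversible_measure nu (density_prob mu).
Proof.
move=> bal f g bcf bcg; have [Mf hf] := bcf.2; have [Mg hg] := bcg.2.
have mf := measurable_within_quadrant _ bcf.1.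
have mg := measurable_within_quadrant _ bcg.1.
have bd u v (Mu Mv : R) : (forall z, E z -> `|u z| <= Mu) ->
    (forall z, E z -> `|v z| <= Mv) ->
    forall z, E z -> `|u z * v z| <= `|Mu| * `|Mv|.
  move=> uM vM z Ez; rewrite normrM ler_pM//.
    by rewrite (le_trans (uM z Ez))// ler_norm.
  by rewrite (le_trans (vM z Ez))// ler_norm.
apply: (ae_eq_weight _ _ (`|Mf| * `|Mg|) (`|Mf| * `|Mg|)).
- by apply: measurable_funM => //; exact: measurable_redist_op.
- by apply: bd => //; exact: redist_op_le.
- by apply: measurable_funM => //; exact: measurable_redist_op.
- by apply: bd => //; exact: redist_op_le.
apply: aeS bal => s hs s0; have b := hs s0.
rewrite (weight_mul_sum (redist_mean nu f) g s Mg s0 b.1 mg hg).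
under [X in _ = weight X s]eq_fun do rewrite mulrC.
rewrite (weight_mul_sum (redist_mean nu g) f s Mf s0 b.1 mf hf).
rewrite (weight_balanced g Mg mg hg s s0 b) (weight_balanced f Mf mf hf s s0 b).
by ring.
Qed.

(** The same computation with g = 1: P f and f have the same density in s. *)
Lemma balanced_invariant :
  {ae leb, forall s, 0 < s -> balanced_at s} ->
  invariant_measure nu (density_prob mu).
Proof.
move=> bal f bcf; have [M hM] := bcf.2.
have mf := measurable_within_quadrant _ bcf.1.
apply: (ae_eq_weight _ _ M M) => //.
- exact: measurable_redist_op.
- exact: redist_op_le.
apply: aeS bal => s hs s0; have b := hs s0.
have := weight_mul_sum (redist_mean nu f) (cst 1) s 1 s0 b.1 ltac:(by [])
  ltac:(by rewrite /= normr1).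
under eq_fun do rewrite mulr1.
move=> ->; rewrite (weight_balanced f M mf hM s s0 b) mulrC; congr (_ * _).
rewrite /weight /radial /slice_mass -RintegralZl//; last 2 first.
- exact: measurable_unit_itv.
- exact: b.1.
by apply: eq_Rintegral => a _; rewrite mul1r.
Qed.

(** The jump conserves x + y, so P commutes with multiplication by functions of x + y. *)
Lemma redist_mean_mul_sum (phi : R -> R) (f : R * R -> R) (s : R) :
  bounded_continuous f -> 0 <= s ->
  redist_mean nu (fun z => phi (z.1 + z.2) * f z) s = phi s * redist_mean nu f s.
Proof.
move=> bcf s0; have [M fM] := bcf.2.
have s_quad a : U a -> E (a * s, (1 - a) * s).
  rewrite /unit_itv/= in_itv/= => /andP[a0 a1].
  split; rewrite /halfline/= in_itv/= andbT; first by rewrite mulr_ge0.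
  by rewrite mulr_ge0// subr_ge0.
rewrite /redist_mean -RintegralZl//; last 2 first.
- exact: measurable_unit_itv.
- apply: (integrable_redist_density nu s _ M); last first.
    by move=> a Ua; apply: fM; exact: s_quad.
  apply: (measurable_comp (@measurable_quadrant R) _ (measurable_within_quadrant f bcf.1)).
    by move=> _ [a Ua <-]; exact: s_quad.
  apply: measurable_funTS; apply/measurable_fun_pairP; split => /=.
    exact: measurable_funM.
  by apply: measurable_funM => //; exact: measurable_funB.
apply: eq_Rintegral => a _ /=.
by rewrite -mulrDl addrCA subrr addr0 mul1r mulrA.
Qed.

Let expx (n : nat) (z : R * R) : R := expR (- (n%:R * z.1)).

Let expx_le1 n z : E z -> `|expx n z| <= 1.
Proof.
move=> [z1 _]; rewrite ger0_norm ?expR_ge0// expR_le1 oppr_le0 mulr_ge0//.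
by move: z1; rewrite /halfline/= in_itv/= andbT.
Qed.

Let continuous_expx n : continuous (expx n).
Proof.
move=> z; apply: (@continuous_comp _ _ _ (fun z : R * R => - (n%:R * z.1)) expR).
  by apply: cvgN; apply: cvgM; [exact: cvg_cst|exact: cvg_fst].
exact: continuous_expR.
Qed.

Let expxS (j n : nat) : bounded_continuous
  (fun z => expR (- (j%:R * (z.1 + z.2))) * expx n z).
Proof.
split.
  apply: continuous_subspaceT => z; apply: cvgM; last exact: continuous_expx.
  apply: (@continuous_comp _ _ _ (fun z : R * R => - (j%:R * (z.1 + z.2))) expR).
    apply: cvgN; apply: cvgM; first exact: cvg_cst.
    by apply: cvgD; [exact: cvg_fst|exact: cvg_snd].
  exact: continuous_expR.
exists 1 => z Ez; rewrite normrM.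
apply: mulr_ile1; [exact: normr_ge0|exact: normr_ge0| |exact: expx_le1].
have [z1 z2] := Ez; move: z1 z2; rewrite /halfline/= !in_itv/= !andbT => z1 z2.
rewrite ger0_norm; last exact: expR_ge0.
rewrite expR_le1 oppr_le0; apply: mulr_ge0; first exact: ler0n.
exact: addr_ge0.
Qed.

Let bc_expx n : bounded_continuous (expx n).
Proof.
by split; [apply: continuous_subspaceT; exact: continuous_expx|exists 1; exact: expx_le1].
Qed.

Hypothesis inv : invariant_measure nu (density_prob mu).

(** For fixed n, testing with exp (- j (x + y)) exp (- n x) for every j says that the difference of
    the two densities in s has Laplace transform zero at each integer j. *)
Lemma invariant_weight (n : nat) : {ae leb, forall s, 0 < s ->
  weight (redist_op nu (expx n)) s = weight (expx n) s}.
Proof.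
have bcn := bc_expx n.
have mn := measurable_within_quadrant _ bcn.1.
have mop := measurable_redist_op _ bcn.
have opM := redist_op_le _ _ bcn (expx_le1 n).
have int1 := integrable_radial _ (intdens _ _ mop opM).
have int2 := integrable_radial _ (intdens _ _ mn (expx_le1 n)).
have mpos := @measurable_posline R.
pose w s := weight (redist_op nu (expx n)) s - weight (expx n) s.
have intw : leb.-integrable posline (EFin \o w).
  have := integrableB mpos int1 int2.
  by apply: eq_integrable.
(* The difference extended by zero to the closed half-line, on which Laplace uniqueness is
   stated. *)
pose h := w \_ posline.
have inth : leb.-integrable (@halfline R) (EFin \o h).
  apply: (@integrableS _ _ _ _ setT) => //; first exact: measurable_halfline.
  have := (integrable_mkcond _ mpos).1 intw.
  by rewrite restrict_EFin.
have h0 := laplace_eq0_ae h 1 ltr01 inth.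
suff lap0 : forall j : nat,
    \int[leb]_(x in @halfline R) (h x * expR (- (j%:R * (1 * x)))) = 0.
  apply: aeS (h0 lap0) => s hs s0.
  have : h s = 0 by apply: hs; rewrite /halfline/= in_itv/= andbT ltW.
  rewrite /h patchE mem_set; last by rewrite /posline/= in_itv/= andbT.
  by move/subr0_eq.
move=> j; pose phi (s : R) := expR (- (j%:R * s)).
have := inv _ (expxS j n).
have mjn := measurable_within_quadrant _ (expxS j n).1.
have [M bdjn] := (expxS j n).2.
have mopjn := measurable_redist_op _ (expxS j n).
have opMjn := redist_op_le _ _ (expxS j n) bdjn.
rewrite (Rintegral_density_radial _ _ mopjn opMjn).
rewrite (Rintegral_density_radial _ _ mjn bdjn).
have i1 := integrable_radial _ (intdens _ _ mopjn opMjn).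
have i2 := integrable_radial _ (intdens _ _ mjn bdjn).
have intd := integrableB mpos i1 i2.
have := RintegralB mpos i1 i2.
rewrite -/(weight _) -/(weight _) => dE eqj.
rewrite eqj subrr in dE; rewrite -dE.
rewrite Rintegral_mkcond [RHS]Rintegral_mkcond.
have -> : (fun x => h x * expR (- (j%:R * (1 * x)))) \_ (@halfline R) =
    (fun x => w x * phi x) \_ posline.
  apply/funext => s; rewrite !patchE mem_setE in_itv/= andbT /h patchE.
  rewrite /posline mem_setE in_itv/= andbT mul1r /phi.
  by case: ltP => [/ltW ->//|_]; rewrite mul0r; case: ifP.
rewrite -!Rintegral_mkcond; congr fine; apply: ae_eq_integral => //.
- apply/measurable_EFinP; apply: measurable_funM.
    by have /integrableP[/measurable_EFinP] := intw.
  apply: measurable_funTS; apply: measurableT_comp => //.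
  by apply: measurableT_comp => //; exact: measurable_funM.
- exact: measurable_int intd.
- apply: aeS ae_integrable_slice => s hs; rewrite /posline/= in_itv/= andbT => s0.
  have {}hs := hs s0; congr EFin.
  rewrite /w mulrBl; congr (_ - _).
  + rewrite mulrC -(weight_mul_sum phi _ s 1 s0 hs mop opM).
    apply: eq_Rintegral => a Ua; congr (_ * (_ * _)).
    have sge : 0 <= a * s + (1 - a) * s by rewrite -mulrDl addrCA subrr addr0 mul1r ltW.
    exact/esym/(redist_mean_mul_sum phi (expx n) (a * s + (1 - a) * s)).
  + by rewrite mulrC -(weight_mul_sum phi _ s 1 s0 hs mn (expx_le1 n)).
Qed.

(** At a fixed s the equalities for all n say that D [nu s] and the slice, as functions of a, have
    the same Laplace transform on the lattice of multiples of s. *)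
Lemma invariant_balanced : {ae leb, forall s, 0 < s -> balanced_at s}.
Proof.
(* There are countably many n, so one null set of s serves them all. *)
have all_n := ae_foralln invariant_weight.
apply: aeS (aeI all_n ae_integrable_slice) => s [hn hi] s0.
have {}hi := hi s0; have mU := @measurable_unit_itv R.
split => //; rewrite -/(slice_mass s); set D := slice_mass s.
pose k a := D * nu s a - slice s a.
have intnu : leb.-integrable U (EFin \o (fun a => D * nu s a)).
  by apply: (integrable_redist_density nu s (cst D) `|D|) => // a Ua.
have intk : leb.-integrable U (EFin \o k).
  by have := integrableB mU intnu hi; exact: eq_integrable.
pose h := k \_ U.
have inth : leb.-integrable (@halfline R) (EFin \o h).
  apply: (@integrableS _ _ _ _ setT) => //; first exact: measurable_halfline.
  by have := (integrable_mkcond _ mU).1 intk; rewrite restrict_EFin.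
(* At x = a s the test function exp (- n x) is exp (- n s a), hence the lattice step s. *)
have h0 := laplace_eq0_ae h s s0 inth.
suff lap0 : forall n : nat,
    \int[leb]_(x in @halfline R) (h x * expR (- (n%:R * (s * x)))) = 0.
  apply: aeS (h0 lap0) => a ha Ua.
  have : h a = 0.
    apply: ha; move: Ua; rewrite /unit_itv /halfline/= !in_itv/= andbT.
    by case/andP.
  by rewrite /h patchE mem_set// => /subr0_eq.
move=> n.
have bcn := bc_expx n.
have mn := measurable_within_quadrant _ bcn.1.
have := hn n s0.
have := weight_mul_sum (redist_mean nu (expx n)) (cst 1) s 1 s0 hi ltac:(by [])
  ltac:(by rewrite /= normr1).
under eq_fun do rewrite mulr1.
move=> ->.
have -> : weight (cst 1) s = s * D.
  rewrite /weight /radial /D /slice_mass -RintegralZl//.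
  by apply: eq_Rintegral => a _; rewrite mul1r.
have ms := measurable_slice _ s mn s0.
have bs a : U a -> `|expx n (a * s, (1 - a) * s)| <= 1.
  by move=> Ua; apply: expx_le1; exact: slice_quadrant.
have ie : leb.-integrable U (EFin \o (fun a => expx n (a * s, (1 - a) * s) * slice s a)).
  have : leb.-integrable U ((EFin \o (fun a : R => expx n (a * s, (1 - a) * s))%R) \* (EFin \o slice s))%E.
    apply: integrableMr => //.
    exists 1; split; first exact: num_real.
    by move=> r r1 a Ua; rewrite /= (le_trans (bs a Ua))// ltW.
  exact: eq_integrable.
have ine := integrable_redist_density nu s _ 1 ms bs.
rewrite /weight /radial RintegralZl// => /eqP.
rewrite mulrCA (inj_eq (mulfI (lt0r_neq0 s0))) /redist_mean mulrC -RintegralZl//.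
rewrite -subr_eq0 -RintegralB//; last first.
  have := integrableZl mU D ine; exact: eq_integrable.
move=> /eqP <-.
rewrite Rintegral_mkcond [RHS]Rintegral_mkcond; apply: eq_Rintegral => a _.
rewrite !patchE /h patchE.
case: ifPn => [_|/negP nH].
  case: ifPn => [_|_]; last by rewrite mul0r.
  by rewrite /k /expx/= (mulrC s a) /slice; ring.
case: ifPn => // /set_mem Ua; exfalso; apply: nH; apply/mem_set.
by move: Ua; rewrite /unit_itv /halfline/= !in_itv/= andbT => /andP[].
Qed.

End invariance.

(** * The Gamma integral and its Laplace transform *)

Section gamma.
Context {R : realType}.
Local Notation leb := (@lebesgue_measure R).
Local Notation H := (@halfline R).

Lemma is_derive_powR (x b : R) : 0 < x ->
  is_derive x 1 (fun y => y `^ b) (b * x `^ (b - 1)).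
Proof.
move=> x0; have xi : x \in `]0, +oo[ by rewrite in_itv/= x0.
apply: DeriveDef; first exact: derivable_powR.
by rewrite -derive1E powR_derive1.
Qed.

Lemma continuous_powR_gt0 (x b : R) : 0 < x ->
  {for x, continuous (fun y : R => y `^ b)}.
Proof.
move=> x0; apply/differentiable_continuous; rewrite -derivable1_diffP.
by apply: derivable_powR; rewrite in_itv/= x0.
Qed.

(** Yields exp (- x) <= K / (1 + x ^ b) ^ 2. With an integer N >= b, x ^ b <= 1 + x ^ N, and the
    exponential series bounds x ^ N by N! 2 ^ N exp (x / 2); hence 1 + x ^ b <= C exp (x / 2), which
    is squared. *)
Let powR_le_exp (b : R) : 0 < b -> exists2 K : R, 0 < K &
  forall x, 0 < x -> (1 + x `^ b) ^+ 2 <= K * expR x.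
Proof.
move=> b0; pose N := (Num.truncn b).+1.
have bN : b <= N%:R by exact/ltW/truncnS_gt.
pose C : R := 2 + N`!%:R * 2 ^+ N.
have C0 : 0 < C by rewrite /C ltr_wpDr// mulr_ge0// exprn_ge0.
exists (C ^+ 2); first by rewrite exprn_gt0.
move=> y y0.
have e1 : 1 <= expR (y / 2) by rewrite -expR0 ler_expR divr_ge0// ltW.
have yN : y ^+ N <= N`!%:R * 2 ^+ N * expR (y / 2).
  have y2 : 0 <= y / 2 by rewrite divr_ge0// ltW.
  have := @expR_ge1Dxn _ _ (Num.truncn b) y2.
  move=> h; have {}h : (y / 2) ^+ N / N`!%:R <= expR (y / 2).
    by rewrite (le_trans _ h)// lerDr.
  move: h; rewrite ler_pdivrMr ?ltr0n ?fact_gt0// exprMn exprVn.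
  by rewrite ler_pdivrMr ?exprn_gt0//; move=> h; rewrite (le_trans h)// [leRHS]mulrC mulrA.
have yb : y `^ b <= 1 + y ^+ N.
  have [y1|y1] := leP 1 y.
    rewrite -(powR_mulrn N (ltW y0)) (le_trans (ler_powR y1 bN))// lerDr//.
  rewrite (@le_trans _ _ 1)//; last by rewrite lerDl exprn_ge0// ltW.
  by rewrite -(powRr0 y); apply: ger_powR; [rewrite y0 ltW|exact: ltW].
have -> : expR y = expR (y / 2) ^+ 2 by rewrite -expRM_natr divfK.
rewrite -exprMn lerXn2r ?nnegrE ?addr_ge0 ?powR_ge0 ?mulr_ge0 ?expR_ge0 ?(ltW C0)//.
rewrite /C mulrDl; lra.
Qed.

(** Its values lie between -1 and 0, so any increment of F is at most 1. *)
Let F (b x : R) : R := - (1 + x `^ b)^-1.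

Let f (b x : R) : R := b * x `^ (b - 1) * (1 + x `^ b) ^- 2.

Let is_derive_F (b x : R) : 0 < x -> is_derive x 1 (F b) (f b x).
Proof.
move=> x0; have n0 : 1 + x `^ b != 0 by rewrite gt_eqF// ltr_pwDl// powR_ge0.
have d1 : is_derive x 1 (fun y => 1 + y `^ b) (b * x `^ (b - 1)).
  rewrite -[X in is_derive _ _ _ X]add0r; apply: is_deriveD.
  exact: is_derive_powR.
have dV := @is_deriveV R (fun y => 1 + y `^ b) x _ 1 n0 d1.
apply: (@is_derive_eq _ _ _ _ _ _ _ _ (is_deriveN dV)).
by rewrite scaleNr opprK; exact: mulrC.
Qed.

Let FTC_F (b u v : R) : 0 < u -> u < v ->
  (\int[leb]_(x in `[u, v]) (f b x)%:E = (F b v - F b u)%:E)%E.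
Proof.
move=> u0 uv; rewrite EFinB.
have pos x : x \in `[u, v] -> 0 < x.
  by rewrite in_itv/= => /andP[+ _]; exact: lt_le_trans.
have cF x : 0 < x -> {for x, continuous (F b)}.
  move=> x0; apply/differentiable_continuous; rewrite -derivable1_diffP.
  by have [] := is_derive_F b x x0.
apply: continuous_FTC2 => //.
- apply/continuous_in_subspaceT => x /set_mem/pos x0.
  have n0 : 1 + x `^ b != 0 by rewrite gt_eqF// ltr_pwDl// powR_ge0.
  apply: cvgM; first by apply: cvgM; [exact: cvg_cst|exact: continuous_powR_gt0].
  apply: cvgV; first by rewrite expf_neq0.
  rewrite expr2; apply: cvgM; (apply: cvgD; [exact: cvg_cst|exact: continuous_powR_gt0]).
- split.
  + move=> x /subset_itv_oo_cc/pos x0; by have [] := is_derive_F b x x0.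
  + by apply: cvg_at_right_filter; apply: cF.
  + by apply: cvg_at_left_filter; apply: cF; exact: lt_trans uv.
- move=> x /subset_itv_oo_cc/pos x0; rewrite derive1E.
  by have [] := is_derive_F b x x0.
Qed.

Let g (b x : R) : R := x `^ (b - 1) * expR (- x).

Lemma measurable_gamma (b : R) (D : set (measurableTypeR R)) :
  measurable_fun D (fun x => x `^ (b - 1) * expR (- x)).
Proof.
apply: measurable_funTS; apply: measurable_funM; first exact: measurable_powR.
by apply: measurableT_comp.
Qed.

(* A multiple of the derivative of the bounded function [- 1 / (1 + x ^ b)]
   dominates [x ^ (b - 1) exp (- x)]. *)
Lemma integrable_gamma (b : R) : 0 < b ->
  leb.-integrable H (EFin \o (fun x => x `^ (b - 1) * expR (- x))).
Proof.
move=> b0; apply/integrableP; split.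
  by apply/measurable_EFinP; exact: measurable_gamma.
have [K K0 hK] := powR_le_exp b b0.
have mg D : measurable_fun D (fun x => `|(g b x)%:E|%E).
  by apply: measurableT_comp => //; apply/measurable_EFinP; exact: measurable_gamma.
rewrite /halfline -integral_itv_obnd_cbnd; last exact: mg.
(* Compact intervals avoid 0, where the power may be singular. The shift by 2 keeps the endpoints
   distinct at n = 0. *)
pose S (n : nat) : set (measurableTypeR R) := `[n.+2%:R^-1, n.+2%:R]%classic.
have SE : `]0%R, +oo[%classic = \bigcup_n S n.
  apply/seteqP; split => x; rewrite /S/= in_itv/= ?andbT; last first.
    move=> [n _] /=; rewrite in_itv/= => /andP[+ _]; apply: lt_le_trans.
    by rewrite invr_gt0 ltr0n.
  move=> x0; exists (maxn (Num.truncn x) (Num.truncn x^-1)) => //=.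
  rewrite in_itv/=; set n := maxn _ _.
  have le_n (u : R) : (Num.truncn u <= n)%N -> u <= n.+2%:R.
    move=> un; apply: (le_trans (ltW (truncnS_gt u))).
    by rewrite ler_nat ltnS leqW.
  rewrite invf_ple ?posrE ?ltr0n// !le_n//; first exact: leq_maxl.
  exact: leq_maxr.
have ndS : nondecreasing_seq S.
  move=> m n mn; rewrite subsetEset => x; rewrite /S/= !in_itv/= => /andP[x1 x2].
  apply/andP; split; last by rewrite (le_trans x2)// ler_nat !ltnS.
  by rewrite (le_trans _ x1)// lef_pV2 ?posrE ?ltr0n// ler_nat !ltnS.
have mS n : measurable (S n) by exact: measurable_itv.
have := @ge0_nondecreasing_set_cvg_integral _ _ _ S (fun x => `|(g b x)%:E|%E)
  leb ndS mS (fun n => mg (S n)) (fun _ _ _ => abse_ge0 _).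
rewrite -SE => cv; rewrite -(cvg_lim _ cv)//.
(* On each interval the integrand is at most K / b times the derivative of F, whose integral is at
   most 1. *)
apply: (@le_lt_trans _ _ (K / b)%:E); last exact: ltry.
apply: lime_le; first by apply/cvg_ex; eexists; exact: cv.
apply: nearW => n.
have Sgt0 x : S n x -> 0 < x.
  by rewrite /S/= in_itv/= => /andP[+ _]; apply: lt_le_trans; rewrite invr_gt0 ltr0n.
have f_ge0 x : 0 <= f b x.
  by rewrite /f !mulr_ge0 ?powR_ge0 ?invr_ge0 ?exprn_ge0 ?addr_ge0 ?powR_ge0// ltW.
have mf : measurable_fun (S n) (fun x => (K / b * f b x)%:E).
  apply/measurable_EFinP; apply: measurable_funTS; apply: measurable_funM => //.
  apply: measurable_funM.
    by apply: measurable_funM => //; exact: measurable_powR.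
  rewrite (_ : (fun x => _) =
      (fun y => y `^ (-1)) \o (fun x => (1 + x `^ b) ^+ 2)); last first.
    by apply/funext => x; rewrite /= powR_inv1// exprn_ge0// addr_ge0// powR_ge0.
  apply: measurableT_comp; [exact: measurable_powR|apply: measurable_funX].
  by apply: measurable_funD => //; exact: measurable_powR.
apply: (@le_trans _ _ (\int[leb]_(x in S n) (K / b * f b x)%:E)%E).
  apply: ge0_le_integral => //.
  - exact: mg.
  - move=> x /Sgt0 x0; rewrite lee_fin ger0_norm ?mulr_ge0 ?powR_ge0 ?expR_ge0//.
    rewrite /g /f mulrA mulrA divfK ?gt_eqF// (mulrC K) -mulrA.
    rewrite ler_wpM2l ?powR_ge0// expRN ler_pdivlMr ?exprn_gt0 ?ltr_pwDl ?powR_ge0//.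
    by rewrite mulrC ler_pdivrMr ?expR_gt0//; exact: hK.
under eq_integral do rewrite EFinM.
rewrite ge0_integralZl//; last 3 first.
- by apply/measurable_EFinP; have /measurable_EFinP h := mf;
    have : measurable_fun (S n) (fun x => (K / b)^-1 * (K / b * f b x));
    [exact: measurable_funM|apply: eq_measurable_fun => x _;
     rewrite mulKf// mulf_neq0 ?invr_neq0 ?gt_eqF].
- by move=> x _; rewrite lee_fin.
- by rewrite lee_fin divr_ge0// ltW.
rewrite FTC_F ?invr_gt0 ?ltr0n//; last first.
  by rewrite (@lt_trans _ _ 1)// ?invf_lt1 ?ltr1n ?ltr0n.
rewrite -EFinM lee_fin ler_piMr ?divr_ge0 ?(ltW K0) ?(ltW b0)// /F opprK.
set p := n.+2%:R^-1 `^ b; set q := n.+2%:R `^ b.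
have p0 : 0 <= p by exact: powR_ge0.
have q0 : 0 <= q by exact: powR_ge0.
have : (1 + p)^-1 <= 1 by rewrite invf_le1 ?lerDl// ltr_pwDl.
have : 0 <= (1 + q)^-1 by rewrite invr_ge0 addr_ge0.
lra.
Qed.

(** A zero integral would make the nonnegative integrand vanish almost everywhere, but it is
    positive on [1, 2]. *)
Lemma gamma_function_gt0 (b : R) : 0 < b -> 0 < gamma_function b.
Proof.
move=> b0; have ig := integrable_gamma b b0.
have ge0 : 0 <= gamma_function b.
  by apply: Rintegral_ge0 => x _; rewrite mulr_ge0 ?powR_ge0 ?expR_ge0.
rewrite lt_neqAle ge0 andbT; apply/eqP => e0.
have int0 : (\int[leb]_(x in H) `|(g b x)%:E| = 0)%E.
  rewrite -[RHS]/(0%:E) e0 /gamma_function /Rintegral fineK; last first.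
    exact: (integrable_fin_num measurable_halfline ig).
  apply: eq_integral => x _.
  by rewrite /= ger0_norm// mulr_ge0 ?powR_ge0 ?expR_ge0.
have /(ae_eq_integral_abs leb measurable_halfline) := int0.
have /integrableP[mg _] := ig.
move=> /(_ mg) [N [mN N0 sub]].
pose J : set (measurableTypeR R) := `[1, 2]%classic.
have : (leb J <= leb N)%E.
  apply: le_measure; rewrite ?inE//; first exact: measurable_itv.
  move=> x; rewrite /J/= in_itv/= => /andP[x1 _]; apply: sub => /= h.
  have x0 : 0 < x by rewrite (lt_le_trans _ x1).
  have /eqP := h ltac:(by rewrite /halfline/= in_itv/= andbT ltW).
  by rewrite eqe mulf_eq0 !gt_eqF ?powR_gt0 ?expR_gt0.
rewrite N0 /J lebesgue_measure_itv/= lte_fin ltr1n/= -EFinB lee_fin; lra.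
Qed.

(** The substitution x = a / t; the finite value so obtained also gives integrability, the integrand
    being nonnegative. *)
Lemma gamma_laplace (b t : R) : 0 < b -> 0 < t ->
  leb.-integrable H (EFin \o (fun x => x `^ (b - 1) * expR (- (t * x)))) /\
  \int[leb]_(x in H) (x `^ (b - 1) * expR (- (t * x))) =
  gamma_function b * t `^ (- b).
Proof.
move=> b0 t0.
have mf (D : set (measurableTypeR R)) :
    measurable_fun D (fun x => x `^ (b - 1) * expR (- (t * x))).
  apply: measurable_funTS; apply: measurable_funM; first exact: measurable_powR.
  by apply: measurableT_comp => //; apply: measurableT_comp => //; exact: measurable_funM.
have fge0 x : 0 <= x `^ (b - 1) * expR (- (t * x)).
  by rewrite mulr_ge0 ?powR_ge0 ?expR_ge0.
have key : (\int[leb]_(x in H) (x `^ (b - 1) * expR (- (t * x)))%:E =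
    (gamma_function b * t `^ (- b))%:E)%E.
  rewrite (ge0_integral_scale_halfline t^-1 _); last 3 first.
  - by rewrite invr_gt0.
  - by apply/measurable_EFinP; exact: mf.
  - by move=> x _; rewrite lee_fin.
  have -> : (\int[leb]_(a in H) ((t^-1 * a) `^ (b - 1) * expR (- (t * (t^-1 * a))))%:E =
      (t `^ (1 - b))%:E * \int[leb]_(a in H) (a `^ (b - 1) * expR (- a))%:E)%E.
    rewrite -ge0_integralZl//; last 4 first.
    - exact: measurable_halfline.
    - by apply/measurable_EFinP; exact: measurable_gamma.
    - by move=> x _; rewrite lee_fin mulr_ge0 ?powR_ge0 ?expR_ge0.
    - by rewrite lee_fin powR_ge0.
    apply: eq_integral => a /set_mem; rewrite /halfline/= in_itv/= andbT => a0.
    rewrite -EFinM; congr EFin; rewrite mulVKf ?gt_eqF// powRM ?invr_ge0 ?(ltW t0)//.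
    by rewrite -powR_inv1 ?ltW// -powRrM mulN1r opprB mulrA.
  rewrite -[X in (_ * (_ * X))%E](fineK (integrable_fin_num measurable_halfline (integrable_gamma b b0))).
  rewrite -!EFinM; congr EFin; rewrite mulrA mulrC; congr (_ * _).
  rewrite -powR_inv1 ?ltW// -powRD; last by rewrite (gt_eqF t0) implybT.
  by congr powR; ring.
split; last by rewrite /Rintegral key.
apply/integrableP; split; first by apply/measurable_EFinP; exact: mf.
under eq_integral do rewrite /= ger0_norm//.
by rewrite key ltry.
Qed.

End gamma.

Section density_positive.
Context d (T : measurableType d) (R : realType).
Variables (m : {measure set T -> \bar R}) (D : set T) (f : prob_density m D).

(** If the integral were zero, g f and therefore f would vanish almost everywhere, against the total
    mass 1. *)
Lemma density_integral_gt0 (g : T -> R) (M : R) : measurable_fun D g ->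
  (forall x, D x -> `|g x| <= M) -> (forall x, D x -> 0 <= g x) ->
  {ae m, forall x, D x -> g x != 0} -> 0 < \int[m]_(x in D) (g x * f x).
Proof.
move=> mg gM g0 gneq0; have mD := density_dom f.
have ig := integrable_density_mul _ _ _ _ _ f g M mg gM.
have ge0 : 0 <= \int[m]_(x in D) (g x * f x).
  by apply: Rintegral_ge0 => x Dx; rewrite mulr_ge0 ?g0 ?(density_ge0 f Dx).
rewrite lt_neqAle ge0 andbT; apply/eqP => e0.
have int0 : (\int[m]_(x in D) `|(g x * f x)%:E| = 0)%E.
  rewrite -[RHS]/(0%:E) e0 /Rintegral fineK; last first.
    exact: (integrable_fin_num mD ig).
  apply: eq_integral => x /set_mem Dx.
  by rewrite /= ger0_norm// mulr_ge0 ?g0 ?(density_ge0 f Dx).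
have /(ae_eq_integral_abs m mD) := int0.
have /integrableP[mgf _] := ig.
move=> /(_ mgf) gf0; have f1 := density_integral f.
suff : (\int[m]_(x in D) (f x)%:E = 0)%E.
  by rewrite f1 => /eqP; rewrite eqe oner_eq0.
transitivity (\int[m]_(x in D) (cst 0 x))%E; last exact: integral0.
apply: ae_eq_integral => //.
  by apply/measurable_EFinP; exact: density_measurable.
apply: aeS (aeI gneq0 gf0) => x [gx gfx] Dx; have := gfx Dx.
by move=> /eqP; rewrite eqe mulf_eq0 (negbTE (gx Dx))/= => /eqP ->.
Qed.

End density_positive.
Arguments density_integral_gt0 {d T R m D} f.

(** * Derivatives of the Laplace transform of mu *)

Section moments.
Context {R : realType}.
Local Notation leb := (@lebesgue_measure R).
Local Notation leb2 := (leb \x leb)%E.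
Local Notation H := (@halfline R).
Local Notation E := (@quadrant R).
Local Notation U := (@unit_itv R).
Variable mu : prob_density leb H.

Let wexp (p : nat) (t x : R) : R := x ^+ p * expR (- (t * x)).

(** A single term of the exponential series: (t x) ^ p / p! <= exp (t x). *)
Lemma exp_moment_bound (p : nat) (t x : R) : 0 < t -> H x ->
  `|x ^+ p * expR (- (t * x))| <= p`!%:R / t ^+ p.
Proof.
rewrite /halfline/= in_itv/= andbT => t0 x0.
have tx0 : 0 <= t * x by rewrite mulr_ge0// ltW.
rewrite ger0_norm ?mulr_ge0 ?exprn_ge0 ?expR_ge0// expRN.
rewrite ler_pdivrMr ?expR_gt0// mulrAC ler_pdivlMr ?exprn_gt0//.
case: p => [|p]; first by rewrite !expr0 mulr1 mul1r -expR0 ler_expR.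
have := @expR_ge1Dxn _ _ p tx0 => h.
have {}h : (t * x) ^+ p.+1 / (p.+1)`!%:R <= expR (t * x).
  by rewrite (le_trans _ h)// lerDr.
by move: h; rewrite ler_pdivrMr ?ltr0n ?fact_gt0// exprMn mulrC [leRHS]mulrC.
Qed.

Lemma measurable_wexp (p : nat) (t : R) (D : set (measurableTypeR R)) :
  measurable_fun D (fun x => x ^+ p * expR (- (t * x))).
Proof.
apply: measurable_funTS; apply: measurable_funM; first exact: measurable_funX.
by apply: measurableT_comp => //; apply: measurableT_comp => //; exact: measurable_funM.
Qed.

(** Up to the sign (-1) ^ p, the p-th derivative at t of the Laplace transform of mu. *)
Definition moment (p : nat) (t : R) : R :=
  \int[leb]_(x in H) (x ^+ p * expR (- (t * x)) * mu x).

Lemma integrable_moment (p : nat) (t : R) : 0 < t ->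
  leb.-integrable H (EFin \o (fun x => x ^+ p * expR (- (t * x)) * mu x)).
Proof.
move=> t0; apply: (integrable_density_mul _ _ _ _ _ mu (wexp p t) (p`!%:R / t ^+ p)).
  exact: measurable_wexp.
by move=> x Hx; exact: exp_moment_bound.
Qed.

Lemma moment_gt0 (p : nat) (t : R) : 0 < t -> 0 < moment p t.
Proof.
move=> t0; apply: (density_integral_gt0 mu (wexp p t) (p`!%:R / t ^+ p)).
- exact: measurable_wexp.
- by move=> x Hx; exact: exp_moment_bound.
- move=> x; rewrite /halfline/= in_itv/= andbT => x0.
  by rewrite mulr_ge0 ?exprn_ge0 ?expR_ge0.
- apply: aeS (ae_neq 0) => x x0 _.
  by rewrite mulf_neq0// ?expf_neq0// gt_eqF// expR_gt0.
Qed.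

Lemma moment0_le1 (t : R) : 0 < t -> moment 0 t <= 1.
Proof.
move=> t0; have im : leb.-integrable H (EFin \o mu).
  have := integrable_density_mul _ _ _ _ _ mu (cst 1) 1 ltac:(by [])
    ltac:(by rewrite /= normr1).
  apply: eq_integrable => //; first exact: measurable_halfline.
  by move=> x _ /=; rewrite mul1r.
have -> : 1 = \int[leb]_(x in H) mu x :> R by rewrite /Rintegral density_integral.
apply: le_Rintegral => //.
- exact: measurable_halfline.
- exact: integrable_moment.
- move=> x Hx; have := exp_moment_bound 0 t x t0 Hx.
  rewrite expr0 mul1r fact0 divr1 ger0_norm ?expR_ge0// => h.
  by rewrite ler_piMl// (density_ge0 mu Hx).
Qed.

Lemma is_derive_moment (p : nat) (t : R) : 0 < t ->
  is_derive t 1 (moment p) (- moment p.+1 t).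
Proof.
(* For s > u the derivative of the integrand is dominated, uniformly in s, by (p + 1)! / u ^ (p + 1)
   times mu; hence a neighbourhood of t bounded away from 0. *)
move=> t0; pose u := t / 2; pose v := t + 1.
have u0 : 0 < u by rewrite divr_gt0.
have It : `]u, v[%classic t.
  by rewrite /= in_itv/=; apply/andP; split; rewrite /u /v; lra.
have Ipos x : `]u, v[%classic x -> u < x by rewrite /= in_itv/= => /andP[].
pose F (s : R) (x : measurableTypeR R) : R := x ^+ p * expR (- (s * x)) * mu x.
have dF (x s : R) : is_derive s 1 (F ^~ x)
    (- (x ^+ p.+1 * expR (- (s * x)) * mu x)).
  have d1 : is_derive s 1 (fun s : R => - x * s) (- x * 1).
    exact: (is_deriveZ (- x) (is_derive_id s 1)).
  have d2 := is_derive1_comp (is_derive_expR (- x * s)) d1.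
  have d3 := is_deriveZ (mu x * x ^+ p) d2.
  have -> : F ^~ x = (mu x * x ^+ p) \*: (expR \o (fun s : R => - x * s)).
    apply/funext => r; rewrite /F /= -[RHS]/(_ * _) mulNr (mulrC x r); ring.
  apply: (@is_derive_eq _ _ _ _ _ _ _ _ d3).
  by rewrite -[LHS]/((mu x * x ^+ p) * (_ * (- x * 1))) mulNr (mulrC x s) exprS; ring.
pose G (x : measurableTypeR R) : R := `|(p.+1)`!%:R / u ^+ p.+1 * mu x|.
have intF s : `]u, v[%classic s -> leb.-integrable H (EFin \o F s).
  by move=> /Ipos us; apply: integrable_moment; exact: lt_trans us.
have derF s x : `]u, v[%classic s -> H x -> derivable (F ^~ x) s 1.
  by move=> _ _; have [] := dF x s.
have G0 x : 0 <= G x by exact: normr_ge0.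
have intG : leb.-integrable H (EFin \o G).
  apply: integrable_norm.
  apply: (integrable_density_mul _ _ _ _ _ mu
    (cst ((p.+1)`!%:R / u ^+ p.+1)) `|(p.+1)`!%:R / u ^+ p.+1|) => //.
have d1E s x : partial1of2 F s x = - (x ^+ p.+1 * expR (- (s * x)) * mu x).
  by rewrite partial1of2E; have [] := dF x s.
have Gub s x : `]u, v[%classic s -> H x -> `|partial1of2 F s x| <= G x.
  have C0 : 0 <= (p.+1)`!%:R / u ^+ p.+1 by rewrite divr_ge0// exprn_ge0// ltW.
  move=> /Ipos us Hx; rewrite d1E normrN /G normrM [leRHS]normrM ler_wpM2r//.
  rewrite (ger0_norm C0).
  have s0 := lt_trans u0 us.
  apply: le_trans (exp_moment_bound p.+1 u x u0 Hx).
  move: Hx; rewrite /halfline/= in_itv/= andbT => x0.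
  rewrite !normrM ler_wpM2l// !ger0_norm ?expR_ge0// ler_expR lerN2 ler_wpM2r//.
  exact: ltW.
apply: DeriveDef.
  exact: (derivable_under_integral measurable_halfline It intF derF G0 intG Gub).
rewrite -derive1E.
have := differentiation_under_integral measurable_halfline It intF derF G0 intG Gub.
rewrite -/(moment p) => ->.
under eq_Rintegral do rewrite d1E -mulN1r.
rewrite RintegralZl ?mulN1r//; first exact: measurable_halfline.
exact: integrable_moment.
Qed.

Lemma Rintegral_prod_density (u v : measurableTypeR R -> R) :
  measurable_fun H u -> measurable_fun H v ->
  (forall x, H x -> 0 <= u x) -> (forall x, H x -> 0 <= v x) ->
  leb.-integrable H (EFin \o (fun x => u x * mu x)) ->
  leb.-integrable H (EFin \o (fun x => v x * mu x)) ->
  \int[density_prob (prod_density mu)]_(z in E) (u z.1 * v z.2) =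
  (\int[leb]_(x in H) (u x * mu x)) * \int[leb]_(y in H) (v y * mu y).
Proof.
move=> mu_ mv u0 v0 iu iv.
have mE := @measurable_quadrant R.
have mH := @measurable_halfline R.
rewrite Rintegral_density; last first.
  have mu1 : measurable_fun E (u \o fst).
    apply: (measurable_comp mH _ mu_); first by move=> _ [z [z1 _] <-].
    exact: measurable_funTS.
  have mv2 : measurable_fun E (v \o snd).
    apply: (measurable_comp mH _ mv); first by move=> _ [z [_ z2] <-].
    exact: measurable_funTS.
  exact: measurable_funM mu1 mv2.
pose a := (fun x => u x * mu x) \_ H.
pose b := (fun x => v x * mu x) \_ H.
have ma : measurable_fun setT a.
  by apply/(measurable_restrictT _ mH); apply: measurable_funM => //; exact: density_measurable.
have mb : measurable_fun setT b.
  by apply/(measurable_restrictT _ mH); apply: measurable_funM => //; exact: density_measurable.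
have a0 x : 0 <= a x.
  by apply: restrict_ge0 => y Hy; rewrite mulr_ge0 ?u0 ?(density_ge0 mu Hy).
have b0 x : 0 <= b x.
  by apply: restrict_ge0 => y Hy; rewrite mulr_ge0 ?v0 ?(density_ge0 mu Hy).
have ib : leb.-integrable setT (EFin \o b).
  by have := (integrable_mkcond _ mH).1 iv; rewrite restrict_EFin.
have bE : (\int[leb]_y (b y)%:E = (\int[leb]_y b y)%:E)%E.
  by rewrite /Rintegral fineK//; exact: (integrable_fin_num measurableT ib).
rewrite Rintegral_mkcond [X in _ = X * _]Rintegral_mkcond.
rewrite [X in _ = _ * X]Rintegral_mkcond -/a -/b.
have -> : (fun z => u z.1 * v z.2 * prod_density mu z) \_ E =
    (fun z => a z.1 * b z.2).
  apply/funext => -[x y]; rewrite /a /b !patchE /quadrant in_setX/=.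
  by case: (x \in H); case: (y \in H); rewrite /= ?mul0r ?mulr0//; ring.
rewrite {1}/Rintegral fubini_tonelli1; last 2 first.
- apply/measurable_EFinP; apply: measurable_funM.
    exact: (measurableT_comp ma measurable_fst).
  exact: (measurableT_comp mb measurable_snd).
- by move=> z; rewrite lee_fin mulr_ge0.
rewrite (_ : (\int[leb]_x _)%E = (\int[leb]_x ((\int[leb]_y b y)%:E * (a x)%:E))%E); last first.
  apply: eq_integral => x _; rewrite /fubini_F/=.
  under eq_integral do rewrite EFinM.
  rewrite ge0_integralZl ?bE 1?muleC//.
  + exact/measurable_EFinP.
  + by move=> y _; rewrite lee_fin.
  + by rewrite lee_fin.
rewrite ge0_integralZl//; last 3 first.
- exact/measurable_EFinP.
- by move=> x _; rewrite lee_fin.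
- by rewrite lee_fin; apply: Rintegral_ge0.
rewrite mulrC [X in _ = _ * X]/Rintegral fineM//.
have : leb.-integrable setT (EFin \o a).
  by have := (integrable_mkcond _ mH).1 iu; rewrite restrict_EFin.
exact: integrable_fin_num.
Qed.

End moments.

(** * The differential equation for the moments *)

Section ode.
Context {R : realType}.

Lemma derive0_constant (F : R -> R) :
  (forall t : R, 0 < t -> is_derive t 1 F 0) ->
  forall s t : R, 0 < s -> 0 < t -> F s = F t.
Proof.
move=> dF; suff lt_case (s t : R) : 0 < s -> s < t -> F s = F t.
  move=> s t s0 t0; have [st|ts|->//] := ltgtP s t; first exact: lt_case.
  by apply/esym/lt_case.
move=> s0 st.
have [||c _] := @MVT R F (fun=> 0) s t st.
- by move=> x; rewrite in_itv/= => /andP[sx _]; apply: dF; exact: lt_trans sx.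
- apply: derivable_within_continuous => x; rewrite in_itv/= => /andP[sx _].
  by have [] := dF x (lt_le_trans s0 sx).
- by rewrite mul0r => /eqP; rewrite subr_eq0 => /eqP.
Qed.

(* [q = M0 / M1] has derivative [k - 1], so [M0' / M0 = - 1 / q] is explicit. *)
Lemma solve_moment_ode (M0 M1 M2 : R -> R) (k : R) : 1 < k ->
  (forall t : R, 0 < t -> is_derive t 1 M0 (- M1 t)) ->
  (forall t : R, 0 < t -> is_derive t 1 M1 (- M2 t)) ->
  (forall t : R, 0 < t -> 0 < M0 t) -> (forall t : R, 0 < t -> 0 < M1 t) ->
  (forall t : R, 0 < t -> M0 t <= 1) ->
  (forall t : R, 0 < t -> M2 t * M0 t = k * M1 t ^+ 2) ->
  exists b lam C : R, [/\ 0 < b, 0 < lam, 0 < C &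
    forall t : R, 0 < t -> M0 t = C * (t + lam) `^ (- b)].
Proof.
move=> k1 dM0 dM1 M0gt0 M1gt0 M0le1 M2E.
pose kap := k - 1; have kap0 : 0 < kap by rewrite subr_gt0.
pose q t := M0 t * (M1 t)^-1.
have q0 t : 0 < t -> 0 < q t by move=> t0; rewrite mulr_gt0 ?invr_gt0 ?M0gt0 ?M1gt0.
(* The intercept of the affine function q, read off at t = 1. *)
pose d := q 1 - kap.
have qE t : 0 < t -> q t = kap * t + d.
  move=> t0; have h : q t - kap * t = q 1 - kap * 1.
    apply: (@derive0_constant (fun t => q t - kap * t)) => // s s0.
    have M1n0 : M1 s != 0 by rewrite gt_eqF ?M1gt0.
    have d1 := is_deriveV M1n0 (dM1 s s0).
    have d2 := is_deriveM (dM0 s s0) d1.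
    have d3 := is_deriveZ kap (is_derive_id s (1 : R)).
    apply: (@is_derive_eq _ _ _ _ _ _ _ _ (is_deriveB d2 d3)).
    rewrite -[LHS]/(M0 s * (- (M1 s) ^- 2 * - M2 s) + (M1 s)^-1 * - M1 s - kap * 1).
    have -> : M0 s * (- (M1 s) ^- 2 * - M2 s) = (M2 s * M0 s) / M1 s ^+ 2 by ring.
    by rewrite M2E// mulfK ?expf_neq0// mulrN mulVf// /kap; ring.
  by rewrite -[LHS](subrK (kap * t)) h /d; ring.
pose b := kap^-1; have b0 : 0 < b by rewrite invr_gt0.
have kb : b * kap = 1 by rewrite mulVf ?gt_eqF.
(* G is constant: the logarithmic derivative of M0 is - 1 / q, that of q ^ b is b kap / q, and b kap
   = 1. *)
pose G t := M0 t * (kap * t + d) `^ b.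
pose C := G 1.
have lin0 t : 0 < t -> 0 < kap * t + d by move=> t0; rewrite -qE// q0.
have GE t : 0 < t -> G t = C.
  move=> t0; apply: (@derive0_constant G) => // s s0.
  have d1 : is_derive s 1 (fun s : R => kap * s + d) (kap * 1 + 0).
    exact: (is_deriveD (is_deriveZ kap (is_derive_id s (1 : R))) (is_derive_cst d s 1)).
  have d2 := @is_derive1_comp R (fun y => y `^ b) (fun s => kap * s + d) s _ _
    (is_derive_powR _ b (lin0 s s0)) d1.
  have d3 := is_deriveM (dM0 s s0) d2.
  apply: (@is_derive_eq _ _ _ _ _ _ _ _ d3).
  rewrite -[LHS]/(M0 s * (b * (kap * s + d) `^ (b - 1) * (kap * 1 + 0)) +
    (kap * s + d) `^ b * - M1 s).
  have -> : (kap * s + d) `^ b = (kap * s + d) * (kap * s + d) `^ (b - 1).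
    by rewrite mulr_powRB1// ltW// lin0.
  have M0E : M0 s = (kap * s + d) * M1 s.
    by rewrite -qE// /q divfK// gt_eqF ?M1gt0.
  rewrite M0E; set P := _ `^ _; set L := kap * s + d.
  have -> : L * M1 s * (b * P * (kap * 1 + 0)) + L * P * - M1 s =
    L * M1 s * P * (b * kap - 1) by ring.
  by rewrite kb subrr mulr0.
have C0 : 0 < C by rewrite mulr_gt0 ?M0gt0 ?powR_gt0 ?lin0.
have M0E t : 0 < t -> M0 t = C * (kap * t + d) `^ (- b).
  move=> t0; rewrite -(GE t t0) /G powRN mulfK// gt_eqF// powR_gt0//.
  exact: lin0.
have d_ge0 : 0 <= d.
  rewrite leNgt; apply/negP => dlt0.
  (* Halfway to the root - d / kap the affine function equals d / 2 < 0, against its positivity. *)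
  have t0 : 0 < - d / kap / 2 by rewrite !divr_gt0// oppr_gt0.
  have := lin0 _ t0.
  have -> : kap * (- d / kap / 2) + d = d / 2 by field; rewrite gt_eqF.
  by rewrite pmulr_lgt0// => /lt_trans/(_ dlt0); rewrite ltxx.
have d0 : 0 < d.
  rewrite lt_neqAle d_ge0 andbT; apply/eqP => dE.
  (* If d = 0 then M0 t = C (kap t) ^ (- b), and the t with kap t = (C / 2) ^ kap would give M0 t =
     2, against M0 <= 1. *)
  have x0 : 0 < (C / 2) `^ kap by rewrite powR_gt0 ?divr_gt0.
  have t0 : 0 < (C / 2) `^ kap / kap by rewrite divr_gt0.
  have := M0le1 _ t0; have := GE _ t0; rewrite /G -dE addr0.
  rewrite mulrCA mulfV ?gt_eqF// mulr1 -powRrM (mulrC kap) kb.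
  rewrite powRr1 ?divr_ge0 ?(ltW C0)// => GC le1.
  have : C <= C / 2.
    by rewrite -{1}GC ler_piMl// divr_ge0// ltW.
  lra.
exists b, (d / kap), (C * kap `^ (- b)); split => //.
- by rewrite divr_gt0.
- by rewrite mulr_gt0// powR_gt0.
move=> t t0; rewrite M0E// -mulrA -powRM ?(ltW kap0)//; last first.
  by rewrite addr_ge0 ?divr_ge0 ?ltW.
by rewrite mulrDr mulrCA divff ?gt_eqF// mulr1.
Qed.

End ode.

(** * Recovering the Gamma density from its Laplace transform *)

Section gamma_identification.
Context {R : realType}.
Local Notation leb := (@lebesgue_measure R).
Local Notation H := (@halfline R).

(** The unit interval has measure 1, so it is not covered by a null set. This later selects one s,
    and one interior a, at which almost everywhere statements hold. *)
Lemma ae_exists (P : R -> Prop) : {ae leb, forall x, P x} ->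
  exists2 x : R, 0 < x < 1 & P x.
Proof.
move=> [N [mN N0 sub]].
have [[x [x01 nNx]]|no] := pselect (exists x : R, 0 < x < 1 /\ ~ N x).
  exists x => //; have [//|nP] := pselect (P x).
  by exfalso; apply: nNx; exact: sub.
exfalso; pose J : set (measurableTypeR R) := `]0, 1[%classic.
have : (leb J <= leb N)%E.
  apply: le_measure; rewrite ?inE//; first exact: measurable_itv.
  move=> x; rewrite /J/= in_itv/= => x01; have [//|nNx] := pselect (N x).
  by exfalso; apply: no; exists x.
rewrite N0 /J lebesgue_measure_itv/= lte_fin ltr01/= -EFinB lee_fin; lra.
Qed.

Variable mu : prob_density leb H.

(** The transforms are known for t > 0 only, while the uniqueness lattice starts at 0. Both sides
    are therefore multiplied by exp (- x), which moves the lattice to 1, 2, 3, ... *)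
Lemma laplace_gamma_density (b lam C : R) : 0 < b -> 0 < lam ->
  (forall t : R, 0 < t -> moment mu 0 t = C * (t + lam) `^ (- b)) ->
  {ae leb, forall x : R, 0 <= x ->
    mu x = lam `^ b * (x `^ (b - 1) / gamma_function b) * expR (- (lam * x))}.
Proof.
move=> b0 lam0 ME; have mH := @measurable_halfline R.
have G0 := gamma_function_gt0 b b0.
pose c := C / gamma_function b.
pose g (x : R) := x `^ (b - 1) * expR (- (lam * x)).
pose h (x : R) := expR (- x) * (mu x - c * g x).
have lapE n (x : R) : h x * expR (- (n%:R * (1 * x))) =
    x ^+ 0 * expR (- (n.+1%:R * x)) * mu x
    - c * (x `^ (b - 1) * expR (- ((n.+1%:R + lam) * x))).
  rewrite /h /g expr0 mul1r mul1r.
  have -> : expR (- ((n.+1%:R + lam) * x)) =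
      expR (- (n.+1%:R * x)) * expR (- (lam * x)).
    by rewrite -expRD; congr expR; ring.
  have -> : expR (- (n.+1%:R * x)) = expR (- x) * expR (- (n%:R * x)).
    by rewrite -expRD -natr1; congr expR; ring.
  ring.
have tpos n : (0 : R) < n.+1%:R + lam by rewrite addr_gt0.
have im n := integrable_moment mu 0 n.+1%:R (ltr0Sn R n).
have ig n : leb.-integrable H (EFin \o
    (fun x : R => c * (x `^ (b - 1) * expR (- ((n.+1%:R + lam) * x))))).
  have := integrableZl mH c (gamma_laplace b _ b0 (tpos n)).1.
  exact: eq_integrable.
have ih : leb.-integrable H (EFin \o h).
  have := integrableB mH (im 0) (ig 0); apply: eq_integrable => // x _ /=.
  by rewrite -EFinB -lapE !mul0r oppr0 expR0 mulr1.
have lap0 (n : nat) : \int[leb]_(x in H) (h x * expR (- (n%:R * (1 * x)))) = 0.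
  under eq_Rintegral do rewrite lapE.
  rewrite RintegralB// -/(moment mu 0 _) ME ?ltr0n// RintegralZl//; last first.
    exact: (gamma_laplace b _ b0 (tpos n)).1.
  rewrite (gamma_laplace b _ b0 (tpos n)).2 /c mulrA divfK ?gt_eqF//.
  by rewrite subrr.
have muE : {ae leb, forall x, H x -> mu x = c * g x}.
  apply: aeS (laplace_eq0_ae h 1 ltr01 ih lap0) => x hx Hx.
  have /eqP := hx Hx; rewrite mulf_eq0 gt_eqF ?expR_gt0//= subr_eq0.
  by move=> /eqP.
have ilam := gamma_laplace b lam b0 lam0.
(* The total mass of mu is 1, which forces C = lam ^ b. *)
have cE : c * (gamma_function b * lam `^ (- b)) = 1.
  rewrite -ilam.2 -RintegralZl//; last exact: ilam.1.
  transitivity (\int[leb]_(x in H) mu x); last first.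
    by rewrite /Rintegral density_integral.
  apply/esym; congr fine; apply: ae_eq_integral => //.
  - by apply/measurable_EFinP; exact: density_measurable.
  - apply/measurable_EFinP; apply: measurable_funM => //.
    by have /integrableP[/measurable_EFinP] := ilam.1.
  - by apply: aeS muE => x hx Hx; congr EFin; exact: hx.
have {}cE : c = lam `^ b / gamma_function b.
  have l0 : 0 < lam `^ b by exact: powR_gt0.
  apply: (mulIf (lt0r_neq0 (divr_gt0 G0 l0))).
  by rewrite -powRN cE powRN; field; rewrite !gt_eqF.
apply: aeS muE => x hx x0; rewrite hx; last by rewrite /halfline/= in_itv/= andbT.
by rewrite cE /g; ring.
Qed.

End gamma_identification.

(** * Redistribution independent of s: the relation between moments *)

Section independent_redistribution.
Context {R : realType} (nu : redistribution_measure R).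
Local Notation leb := (@lebesgue_measure R).
Local Notation H := (@halfline R).
Local Notation E := (@quadrant R).
Local Notation U := (@unit_itv R).
Variable mu : prob_density leb H.
Hypothesis nu_indep : forall s : R, 0 <= s ->
  {ae leb, forall a, U a -> nu s a = nu 0 a}.
Hypothesis inv : invariant_measure nu (density_prob (prod_density mu)).

Local Notation P := (density_prob (prod_density mu)).

Let mU := @measurable_unit_itv R.
Let mE := @measurable_quadrant R.

(** [nu 0] stands for the common law of all the [nu s]. *)
Definition redist_moment (p : nat) : R := \int[leb]_(a in U) (a ^+ p * nu 0 a).

Let sum_ge0 (z : R * R) : E z -> 0 <= z.1 + z.2.
Proof.
move=> [z1 z2]; move: z1 z2; rewrite /halfline/= !in_itv/= !andbT.
exact: addr_ge0.
Qed.

Let f (p : nat) (t : R) (z : R * R) : R := z.1 ^+ p * expR (- (t * (z.1 + z.2))).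

Let g (p : nat) (t : R) (z : R * R) : R :=
  (z.1 + z.2) ^+ p * expR (- (t * (z.1 + z.2))).

Let pow_unit (p : nat) (a : R) : U a -> `|a ^+ p| <= 1.
Proof.
rewrite /unit_itv/= in_itv/= => /andP[a0 a1].
by rewrite ger0_norm ?exprn_ge0// exprn_ile1.
Qed.

Let mpow (p : nat) : measurable_fun U (fun a : R => a ^+ p).
Proof. exact: measurable_funX. Qed.

Let bc_f (p : nat) (t : R) : 0 < t -> bounded_continuous (f p t).
Proof.
move=> t0; split.
  apply: continuous_subspaceT => z; apply: cvgM.
    apply: (@continuous_comp _ _ _ fst (fun x : R => x ^+ p)); first exact: cvg_fst.
    exact: exprn_continuous.
  apply: (@continuous_comp _ _ _ (fun z : R * R => - (t * (z.1 + z.2))) expR).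
    apply: cvgN; apply: cvgM; first exact: cvg_cst.
    by apply: cvgD; [exact: cvg_fst|exact: cvg_snd].
  exact: continuous_expR.
exists (p`!%:R / t ^+ p) => z [z1 z2].
apply: le_trans (exp_moment_bound p t z.1 t0 z1).
rewrite /f !normrM ler_wpM2l// !ger0_norm ?expR_ge0// ler_expR lerN2.
rewrite ler_wpM2l ?(ltW t0)// lerDl.
by move: z2; rewrite /halfline/= in_itv/= andbT.
Qed.

(** The jump replaces x by e s and keeps s, so x ^ p becomes e ^ p s ^ p, and the mean of e ^ p is
    the same for every s. *)
Let redist_f (p : nat) (t : R) (z : R * R) : E z ->
  redist_op nu (f p t) z = redist_moment p * g p t z.
Proof.
move=> /sum_ge0; rewrite /redist_op /g; set s := z.1 + z.2 => s0.
have ip r := integrable_redist_density nu r _ 1 (mpow p) (fun a Ua => pow_unit p a Ua).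
transitivity (\int[leb]_(e in U) (s ^+ p * expR (- (t * s)) * (e ^+ p * nu s e))).
  apply: eq_Rintegral => e _; rewrite /f /redist_map/= -/s exprMn.
  have -> : e * s + (1 - e) * s = s by ring.
  by ring.
rewrite RintegralZl// mulrC; congr (_ * _); congr fine.
apply: ae_eq_integral => //.
- by have /integrableP[] := ip s.
- by have /integrableP[] := ip 0.
- by apply: aeS (nu_indep s s0) => a ha Ua; rewrite (ha Ua).
Qed.

Let integrable_P (h : R * R -> R) (M : R) : measurable_fun E h ->
  (forall z, E z -> `|h z| <= M) -> P.-integrable E (EFin \o h).
Proof.
move=> mh hM; apply: measurable_bounded_integrable => //.
  by apply: (@le_lt_trans _ _ 1%E); [exact: probability_le1|exact: ltry].
exists M; split; first exact: num_real.
by move=> r Mr z Ez; exact: le_trans (hM z Ez) (ltW Mr).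
Qed.

Let measurable_g (p : nat) (t : R) : measurable_fun E (g p t).
Proof.
apply: measurable_funTS.
have ms : measurable_fun setT (fun z : measurableTypeR R * measurableTypeR R => z.1 + z.2).
  by apply: measurable_funD; [exact: measurable_fst|exact: measurable_snd].
apply: measurable_funM; first exact: measurable_funX.
by apply: measurableT_comp => //; apply: measurableT_comp => //; exact: measurable_funM.
Qed.

Let g_bound (p : nat) (t : R) (z : R * R) : 0 < t -> E z -> `|g p t z| <= p`!%:R / t ^+ p.
Proof.
move=> t0 /sum_ge0 s0; apply: exp_moment_bound => //.
by rewrite /halfline/= in_itv/= andbT.
Qed.

Let invariant_power (p : nat) (t : R) : 0 < t ->
  \int[P]_(z in E) f p t z = redist_moment p * \int[P]_(z in E) g p t z.
Proof.
move=> t0; rewrite -(inv _ (bc_f p t t0)) -RintegralZl//; last first.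
  apply: (integrable_P _ (p`!%:R / t ^+ p)); first exact: measurable_g.
  by move=> z Ez; exact: g_bound.
by apply: eq_Rintegral => z /set_mem Ez; exact: redist_f.
Qed.

Let w (i j : nat) (t : R) (z : R * R) : R :=
  z.1 ^+ i * expR (- (t * z.1)) * (z.2 ^+ j * expR (- (t * z.2))).

Let integral_w (i j : nat) (t : R) : 0 < t ->
  \int[P]_(z in E) w i j t z = moment mu i t * moment mu j t.
Proof.
move=> t0; have ge0 p (x : R) : H x -> 0 <= x ^+ p * expR (- (t * x)).
  rewrite /halfline/= in_itv/= andbT => x0.
  by rewrite mulr_ge0 ?exprn_ge0 ?expR_ge0.
apply: (Rintegral_prod_density mu (fun x => x ^+ i * expR (- (t * x)))
  (fun x => x ^+ j * expR (- (t * x)))).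
- exact: measurable_wexp.
- exact: measurable_wexp.
- exact: ge0.
- exact: ge0.
- exact: integrable_moment.
- exact: integrable_moment.
Qed.

Let integrable_w (i j : nat) (t : R) : 0 < t -> P.-integrable E (EFin \o w i j t).
Proof.
move=> t0; apply: (integrable_P _ ((i`!%:R / t ^+ i) * (j`!%:R / t ^+ j))).
  apply: measurable_funTS; apply: measurable_funM.
    exact: (measurableT_comp (measurable_wexp i t setT) measurable_fst).
  exact: (measurableT_comp (measurable_wexp j t setT) measurable_snd).
move=> z [z1 z2]; rewrite normrM ler_pM//; exact: exp_moment_bound.
Qed.

Let fE (p : nat) (t : R) : f p t = w p 0 t.
Proof.
apply/funext => z; rewrite /f /w expr0 mul1r -mulrA -expRD.
by congr (_ * expR _); ring.
Qed.

Let g1E (t : R) z : g 1 t z = w 1 0 t z + w 0 1 t z.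
Proof.
have eE : expR (- (t * (z.1 + z.2))) = expR (- (t * z.1)) * expR (- (t * z.2)).
  by rewrite -expRD; congr expR; ring.
by rewrite /g /w eE; ring.
Qed.

Let g2E (t : R) z : g 2 t z = w 2 0 t z + (w 1 1 t z + (w 1 1 t z + w 0 2 t z)).
Proof.
have eE : expR (- (t * (z.1 + z.2))) = expR (- (t * z.1)) * expR (- (t * z.2)).
  by rewrite -expRD; congr expR; ring.
by rewrite /g /w eE; ring.
Qed.

(** Under the product measure x and y have the same weighted mean, so x accounts for half of x + y;
    invariance says that it accounts for the fraction [redist_moment 1]. *)
Lemma redist_moment1 : redist_moment 1 = 1 / 2.
Proof.
have i10 := integrable_w 1 0 1 ltr01; have i01 := integrable_w 0 1 1 ltr01.
have := invariant_power 1 1 ltr01; rewrite fE.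
under [X in _ = _ * X]eq_Rintegral do rewrite g1E.
rewrite RintegralD// !integral_w// (mulrC (moment mu 0 1)).
set m := moment mu 1 1 * moment mu 0 1 => mE'.
have m0 : 0 < m by rewrite mulr_gt0 ?moment_gt0.
apply: (mulfI (lt0r_neq0 m0)); lra.
Qed.

(** Invariance tested on x ^ 2 exp (- t (x + y)), with (x + y) ^ 2 expanded into products of
    one-variable moments. *)
Lemma invariant_moment2 (t : R) : 0 < t ->
  moment mu 2 t * moment mu 0 t = redist_moment 2 *
    (2 * (moment mu 2 t * moment mu 0 t) + 2 * moment mu 1 t ^+ 2).
Proof.
move=> t0; have iw i j := integrable_w i j t t0.
have := invariant_power 2 t t0; rewrite fE.
have -> : \int[P]_(z in E) g 2 t z =
    \int[P]_(z in E) (w 2 0 t z + (w 1 1 t z + (w 1 1 t z + w 0 2 t z))).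
  by apply: eq_Rintegral => z _; exact: g2E.
have i3 : P.-integrable E (EFin \o (fun z => w 1 1 t z + w 0 2 t z)).
  by have := integrableD mE (iw 1%N 1%N) (iw 0%N 2%N); exact: eq_integrable.
have i2 : P.-integrable E (EFin \o (fun z => w 1 1 t z + (w 1 1 t z + w 0 2 t z))).
  by have := integrableD mE (iw 1%N 1%N) i3; exact: eq_integrable.
rewrite RintegralD// RintegralD// RintegralD// !integral_w// => h.
by rewrite [LHS]h; congr (_ * _); ring.
Qed.

Let integrable_pow (p : nat) : leb.-integrable U (EFin \o (fun a => a ^+ p * nu 0 a)).
Proof. exact: (integrable_redist_density nu 0 _ 1 (mpow p) (fun a Ua => pow_unit p a Ua)). Qed.

Let ae_neq_unit (c d : R) : {ae leb, forall a : R, U a -> (a - c) * (d - a) != 0}.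
Proof.
apply: aeS (aeI (ae_neq c) (ae_neq d)) => a [ac ad] _.
by rewrite mulf_neq0 ?subr_eq0// eq_sym.
Qed.

(** With mean 1/2, the means of (a - 1/2) ^ 2 and of a (1 - a) are c - 1/4 and 1/2 - c, where c is
    the second moment. Both are strictly positive, since these polynomials vanish only at finitely
    many points, which carry no mass. *)
Lemma redist_moment2_bounds : 1 / 4 < redist_moment 2 < 1 / 2.
Proof.
have i1 := integrable_pow 1; have i2 := integrable_pow 2.
have i0 : leb.-integrable U (EFin \o nu 0).
  have := integrable_pow 0; apply: eq_integrable => // a _ /=.
  by rewrite mul1r.
have quad (c1 c0 : R) : \int[leb]_(a in U) ((a ^+ 2 + c1 * a + c0) * nu 0 a) =
    redist_moment 2 + c1 * redist_moment 1 + c0.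
  have j1 : leb.-integrable U (EFin \o (fun a => c1 * (a ^+ 1 * nu 0 a))).
    by have := integrableZl mU c1 i1; exact: eq_integrable.
  have j0 : leb.-integrable U (EFin \o (fun a => c0 * nu 0 a)).
    by have := integrableZl mU c0 i0; exact: eq_integrable.
  have j10 : leb.-integrable U
      (EFin \o (fun a => c1 * (a ^+ 1 * nu 0 a) + c0 * nu 0 a)).
    by have := integrableD mU j1 j0; exact: eq_integrable.
  transitivity (\int[leb]_(a in U) (a ^+ 2 * nu 0 a +
      (c1 * (a ^+ 1 * nu 0 a) + c0 * nu 0 a))).
    by apply: eq_Rintegral => a _; rewrite expr1; ring.
  rewrite (RintegralD mU i2 j10) (RintegralD mU j1 j0).
  have -> : \int[leb]_(a in U) (c1 * (a ^+ 1 * nu 0 a)) = c1 * redist_moment 1.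
    exact: RintegralZl.
  have -> : \int[leb]_(a in U) (c0 * nu 0 a) = c0 * 1.
    by rewrite -(integral_redist_density nu 0); exact: RintegralZl.
  by rewrite mulr1 addrA.
have m1 := redist_moment1.
have mquad (k1 k0 : R) : measurable_fun U (fun a => a ^+ 2 + k1 * a + k0).
  apply: measurable_funD => //; apply: measurable_funD; first exact: mpow.
  exact: measurable_funM.
have pos (q : R -> R) (k1 k0 e : R) :
    (forall a, U a -> 0 <= q a) -> {ae leb, forall a, U a -> q a != 0} ->
    (forall a, q a = e * (a ^+ 2 + k1 * a + k0)) ->
    0 < e * (redist_moment 2 + k1 * redist_moment 1 + k0).
  move=> q0 qn qE; rewrite -quad -RintegralZl//; last first.
    apply: (integrable_redist_density nu 0 (fun a => a ^+ 2 + k1 * a + k0)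
      (1 + `|k1| + `|k0|)).
      exact: mquad.
    move=> a Ua; rewrite (le_trans (ler_normD _ _))// lerD2r.
    rewrite (le_trans (ler_normD _ _))// lerD ?pow_unit// normrM.
    by rewrite ler_piMr//; have := pow_unit 1 a Ua; rewrite expr1.
  have mq : measurable_fun U q.
    rewrite (_ : q = fun a => e * (a ^+ 2 + k1 * a + k0)); last exact/funext.
    by apply: measurable_funM => //; exact: mquad.
  have qM a : U a -> `|q a| <= `|e| * (1 + `|k1| + `|k0|).
    move=> Ua; rewrite qE normrM ler_wpM2l//.
    rewrite (le_trans (ler_normD _ _))// lerD2r.
    rewrite (le_trans (ler_normD _ _))// lerD ?pow_unit// normrM.
    by rewrite ler_piMr//; have := pow_unit 1 a Ua; rewrite expr1.
  have := density_integral_gt0 (nu 0) q _ mq qM q0 qn.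
  by under eq_Rintegral do rewrite qE -mulrA.
have lo := pos (fun a => (a - 1 / 2) ^+ 2) (-1) (1 / 4) 1.
have hi := pos (fun a => (a - 0) * (1 - a)) (-1) 0 (-1).
have {}lo : 0 < 1 * (redist_moment 2 + -1 * redist_moment 1 + 1 / 4).
  apply: lo => [a _|| a]; first exact: sqr_ge0.
    apply: aeS (ae_neq_unit (1 / 2) (1 / 2)) => a h Ua; apply: contra (h Ua).
    by rewrite sqrf_eq0 => /eqP ->; rewrite mul0r.
  by field.
have {}hi : 0 < -1 * (redist_moment 2 + -1 * redist_moment 1 + 0).
  apply: hi => [a|| a].
  - rewrite /unit_itv/= in_itv/= => /andP[a0 a1].
    by rewrite mulr_ge0// subr_ge0.
  - exact: ae_neq_unit.
  - by ring.
rewrite m1 in lo hi; apply/andP; split; lra.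
Qed.

Lemma invariant_gamma : exists b lam : R, [/\ 0 < b, 0 < lam &
  {ae leb, forall x : R, 0 <= x ->
    mu x = lam `^ b * (x `^ (b - 1) / gamma_function b) * expR (- (lam * x))}].
Proof.
have /andP[lo hi] := redist_moment2_bounds; set c := redist_moment 2 in lo hi.
have c12 : 0 < 1 - 2 * c by lra.
(* The second moment relation reads (1 - 2 c) M_2 M_0 = 2 c M_1 ^ 2. The bound c < 1/2 makes the
   divisor positive and c > 1/4 makes k > 1. *)
pose k := 2 * c / (1 - 2 * c).
have k1 : 1 < k by rewrite /k ltr_pdivlMr//; lra.
have [||||||b [lam [C [b0 lam0 C0 ME]]]] :=
    solve_moment_ode (moment mu 0) (moment mu 1) (moment mu 2) k k1.
- by move=> t; exact: is_derive_moment.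
- by move=> t; exact: is_derive_moment.
- by move=> t; exact: moment_gt0.
- by move=> t; exact: moment_gt0.
- by move=> t; exact: moment0_le1.
- move=> t t0; have := invariant_moment2 t t0; rewrite -/c.
  set x := _ * moment mu 0 t; set y := moment mu 1 t ^+ 2 => xE.
  have kE : (1 - 2 * c) * k = 2 * c by rewrite /k mulrC divfK ?gt_eqF.
  apply: (mulfI (lt0r_neq0 c12)); rewrite [RHS]mulrA kE; lra.
by exists b, lam; split => //; exact: laplace_gamma_density ME.
Qed.

End independent_redistribution.

(** * The Beta law read off from one balanced segment *)

Section beta_identification.
Context {R : realType} (nu : redistribution_measure R).
Local Notation leb := (@lebesgue_measure R).
Local Notation H := (@halfline R).
Local Notation U := (@unit_itv R).
Variable mu : prob_density leb H.

(** In mu (a s) mu ((1 - a) s) the exponentials multiply to exp (- lam s), free of a. What remains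
    is a constant K times the Beta weight, and the total mass 1 of [nu s] identifies D / K with B(b,
    b). *)
Lemma balanced_gamma_beta (b lam s : R) : 0 < b -> 0 < lam -> 0 < s ->
  {ae leb, forall x : R, 0 <= x ->
    mu x = lam `^ b * (x `^ (b - 1) / gamma_function b) * expR (- (lam * x))} ->
  balanced_at nu (prod_density mu) s ->
  {ae leb, forall a : R, U a ->
    nu s a = (beta_function b b)^-1 * a `^ (b - 1) * (1 - a) `^ (b - 1)}.
Proof.
move=> b0 lam0 s0 muE [intD bal]; have mU := @measurable_unit_itv R.
have G0 := gamma_function_gt0 b b0.
set D := \int[leb]_(a in U) _ in bal.
pose w (a : R) := a `^ (b - 1) * (1 - a) `^ (b - 1).
pose K := (lam `^ b / gamma_function b * s `^ (b - 1)) ^+ 2 * expR (- (lam * s)).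
have K0 : 0 < K.
  apply: mulr_gt0; last exact: expR_gt0.
  apply: exprn_gt0; apply: mulr_gt0; last exact: powR_gt0.
  by apply: divr_gt0 => //; exact: powR_gt0.
have mu1 : {ae leb, forall a : R, 0 <= a * s -> mu (a * s) =
    lam `^ b * ((a * s) `^ (b - 1) / gamma_function b) * expR (- (lam * (a * s)))}.
  have := @negligible_affine R s 0 _ s0 muE.
  by apply: aeS => a; rewrite addr0 (mulrC s).
have mu2 : {ae leb, forall a : R, 0 <= (1 - a) * s -> mu ((1 - a) * s) =
    lam `^ b * (((1 - a) * s) `^ (b - 1) / gamma_function b)
    * expR (- (lam * ((1 - a) * s)))}.
  (* The map a |-> (1 - a) s has negative slope, so it is written as the opposite of a |-> s a -
     s. *)
  have := @negligible_affine R s (- s) _ s0 (negligible_opp _ muE).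
  apply: aeS => a; have -> // : - (s * a + - s) = (1 - a) * s by ring.
have key : {ae leb, forall a, U a -> D * nu s a = K * w a}.
  apply: aeS (aeI bal (aeI mu1 mu2)) => a [ha [h1 h2]] Ua; rewrite (ha Ua).
  move: Ua; rewrite /unit_itv/= in_itv/= => /andP[a0 a1].
  have a10 : 0 <= 1 - a by rewrite subr_ge0.
  rewrite -[LHS]/(mu (a * s) * mu ((1 - a) * s)).
  rewrite h1 ?mulr_ge0 ?(ltW s0)// h2 ?mulr_ge0 ?(ltW s0)//.
  rewrite !powRM ?(ltW s0)// /K /w.
  have -> : expR (- (lam * s)) =
      expR (- (lam * (a * s))) * expR (- (lam * ((1 - a) * s))).
    by rewrite -expRD; congr expR; ring.
  by ring.
(* At an interior point a the product K w(a) is positive, so D cannot vanish. *)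
have D0 : D != 0.
  apply/eqP => DE; have [a /andP[a0 a1] ha] := ae_exists _ key.
  have := ha ltac:(by rewrite /unit_itv/= in_itv/= !ltW).
  rewrite DE mul0r => /esym/eqP.
  rewrite gt_eqF//; apply: mulr_gt0 => //.
  by apply: mulr_gt0; apply: powR_gt0; rewrite ?subr_gt0.
have mw : measurable_fun U w.
  apply: measurable_funTS; apply: measurable_funM; first exact: measurable_powR.
  rewrite -[X in measurable_fun _ X]/((fun y => y `^ (b - 1)) \o (fun a : R => 1 - a)).
  by apply: measurableT_comp; [exact: measurable_powR|exact: measurable_funB].
have wE : {ae leb, forall a, U a -> w a = D / K * nu s a}.
  apply: aeS key => a ha Ua; rewrite mulrAC (ha Ua) mulrAC mulfV ?gt_eqF//.
  by rewrite mul1r.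
have inu : leb.-integrable U (EFin \o nu s).
  have := integrable_redist_density nu s (cst 1) 1 ltac:(by [])
    ltac:(by rewrite /= normr1).
  by apply: eq_integrable => // a _ /=; rewrite mul1r.
have mnu : measurable_fun U (nu s) by exact: density_measurable.
have betaE : beta_function b b = D / K.
  transitivity (\int[leb]_(a in U) (D / K * nu s a)).
    congr fine; apply: ae_eq_integral => //.
    - exact/measurable_EFinP.
    - by apply/measurable_EFinP; exact: measurable_funM.
    - by apply: aeS wE => a ha Ua; congr EFin; exact: ha.
  by rewrite RintegralZl// integral_redist_density mulr1.
apply: aeS wE => a ha Ua; rewrite betaE -mulrA -/(w a) (ha Ua) mulKf//.
by rewrite mulf_neq0// invr_neq0// gt_eqF.
Qed.

End beta_identification.

Theorem theorem3p1 (R : realType) (nu : redistribution_measure R) :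
  (forall mu : prob_density (@lebesgue_measure R) (@halfline R),
    (invariant_measure nu (density_prob (prod_density mu)) <->
     {ae (@lebesgue_measure R), forall s : R, 0 < s ->
        let D := \int[@lebesgue_measure R]_(al in @unit_itv R)
                   (mu (al * s) * mu ((1 - al) * s)) in
        D != 0 ->
        {ae (@lebesgue_measure R), forall a : R, 0 <= a <= 1 ->
           nu s a = mu (a * s) * mu ((1 - a) * s) / D}})
    /\
    (invariant_measure nu (density_prob (prod_density mu)) ->
     reversible_measure nu (density_prob (prod_density mu))))
  /\
  (forall mu : prob_density (@lebesgue_measure R \x @lebesgue_measure R)%E
                 (@quadrant R),
    invariant_measure nu (density_prob mu) <->
    {ae (@lebesgue_measure R), forall s : R, 0 < s ->
       let D := \int[@lebesgue_measure R]_(al in @unit_itv R)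
                  mu (al * s, (1 - al) * s) in
       D != 0 ->
       {ae (@lebesgue_measure R), forall a : R, 0 <= a <= 1 ->
          nu s a = mu (a * s, (1 - a) * s) / D}})
  /\
  (forall nu0 : R -> R,
    (forall s : R, 0 <= s ->
       {ae (@lebesgue_measure R), forall a : R, 0 <= a <= 1 ->
          nu s a = nu0 a}) ->
    forall mu : prob_density (@lebesgue_measure R) (@halfline R),
    invariant_measure nu (density_prob (prod_density mu)) ->
    exists b lam : R,
      [/\ 0 < b, 0 < lam,
          {ae (@lebesgue_measure R), forall x : R, 0 <= x ->
             mu x = lam `^ b * (x `^ (b - 1) / gamma_function b)
                    * expR (- (lam * x))} &
          {ae (@lebesgue_measure R), forall a : R, 0 <= a <= 1 ->
             nu0 a = (beta_function b b)^-1
                     * a `^ (b - 1) * (1 - a) `^ (b - 1)}]).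
Proof.
have inv_iff (mu : prob_density (@lebesgue_measure R \x @lebesgue_measure R)%E
    (@quadrant R)) : invariant_measure nu (density_prob mu) <->
    {ae (@lebesgue_measure R), forall s : R, 0 < s -> balanced_at nu mu s}.
  by split; [exact: invariant_balanced|exact: balanced_invariant].
split; [|split].
- move=> mu; split; first exact: iff_trans (inv_iff _) (balanced_iff _ _).
  by move=> /inv_iff; exact: balanced_reversible.
- by move=> mu; exact: iff_trans (inv_iff _) (balanced_iff _ _).
move=> nu0 nuE mu inv.
have nu_indep (s : R) : 0 <= s -> {ae (@lebesgue_measure R),
    forall a : R, unit_itv a -> nu s a = nu 0 a}.
  move=> s0; apply: aeS (aeI (nuE s s0) (nuE 0 (lexx 0))) => a [h1 h2].
  by rewrite /unit_itv/= in_itv/= => a01; rewrite h1// h2.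
have [b [lam [b0 lam0 muE]]] := invariant_gamma nu mu nu_indep inv.
exists b, lam; split => //.
(* A single balanced s is enough, since [nu s] equals [nu0] up to a null set. *)
have [s /andP[s0 _] bal] := ae_exists _ ((inv_iff _).1 inv).
have nuB := balanced_gamma_beta nu mu b lam s b0 lam0 s0 muE (bal s0).
apply: aeS (aeI nuB (nuE s (ltW s0))) => a [h1 h2] a01.
by rewrite -(h2 a01) h1//= /unit_itv/= in_itv.
Qed.
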